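(* Let $\Sigma$ be a universe of items, let $\mathcal{S}=\{(u,S_u)\}_{u\in[n]}$ be a dataset, let $\varepsilon>0$, $\delta\in(0,1)$, let $\Delta_0$ be a positive integer, let $\texttt{ALG}$ be a weighting algorithm and let $h:\mathbb{N}\to\mathbb{R}$. Suppose that $\texttt{ALG}$ has $\ell_2$ sensitivity $\Delta_2\le 1$ and novel $\ell_\infty$ sensitivity satisfying $\Delta_\infty(t)\le h(t)$ for every $t\in[\Delta_0]$. Then the mechanism that runs the weight-and-threshold meta-algorithm $\texttt{WeightAndThreshold}(\mathcal{S},\varepsilon,\delta,\Delta_0,\texttt{ALG},h)$ and releases the pair $(U,\tilde w_{ext})$ is $(\varepsilon,\delta)$-differentially private.
   Context: Setting: $\Sigma$ is an (unknown, possibly infinite) universe of items. A dataset is $\mathcal{S}=\{(u,S_u)\}_{u\in[n]}$ where each $S_u\subseteq\Sigma$ is a finite set of items held by user $u$; write $\mathcal{U}=\bigcup_u S_u$. Two datasets are neighboring if one is obtained from the other by adding a single new user, i.e. $\mathcal{S}'=\mathcal{S}\cup\{(v,S_v)\}$. A randomized algorithm $\mathcal{M}$ is $(\varepsilon,\delta)$-DP if for all neighboring $\mathcal{S},\mathcal{S}'$ (in either order) and all sets $\mathcal{O}$ of outputs, $\Pr(\mathcal{M}(\mathcal{S})\in\mathcal{O})\le e^{\varepsilon}\Pr(\mathcal{M}(\mathcal{S}')\in\mathcal{O})+\delta$. $\Phi$ denotes the standard Gaussian CDF. A weighting algorithm $\texttt{ALG}$ maps a dataset to a weight vector $w:\mathcal{U}\to\mathbb{R}$.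 For neighboring datasets $\mathcal{S}$ and $\mathcal{S}'=\mathcal{S}\cup\{(v,S_v)\}$ in which every user set has at most $\Delta_0$ items, let $w=\texttt{ALG}(\mathcal{S})$, $w'=\texttt{ALG}(\mathcal{S}')$, $\mathcal{U}'=\mathcal{U}\cup S_v$, $T=\mathcal{U}'\setminus\mathcal{U}$ (the novel items) and $t=|T|$. The $\ell_2$ sensitivity $\Delta_2$ is the smallest value such that for all such pairs $\Delta_2\ge\sqrt{\sum_{i\in\mathcal{U}}(w'(i)-w(i))^2+\sum_{i\in T}w'(i)^2}$. The novel $\ell_\infty$ sensitivity $\Delta_\infty(t)$ is the smallest value such that for all such pairs with $|T|=t$, $\Delta_\infty(t)\ge\max_{i\in T}w'(i)$. Meta-algorithm $\texttt{WeightAndThreshold}(\mathcal{S},\varepsilon,\delta,\Delta_0,\texttt{ALG},h)$: (1) choose $\sigma>0$ such that $\Phi\left(\frac{1}{2\sigma}-\varepsilon\sigma\right)-e^{\varepsilon}\Phi\left(-\frac{1}{2\sigma}-\varepsilon\sigma\right)\le\delta/2$ (the Gaussian-mechanism noise for $(\varepsilon,\delta/2)$-DP with sensitivity $1$); (2) set $\rho=\max_{t\in[\Delta_0]}\left(h(t)+\sigma\Phi^{-1}\big((1-\delta/2)^{1/t}\big)\right)$; (3) for each user with $|S_u|\ge\Delta_0$, replace $S_u$ by a uniformly random subset of $\Delta_0$ of its items; (4) compute $w=\texttt{ALG}(\mathcal{S})$ on the capped sets; (5) set $\tilde w(i)=w(i)+Z_i$ for $i\in\mathcal{U}$ with independent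 $Z_i\sim\mathcal{N}(0,\sigma^2)$; (6) let $U=\{i\in\mathcal{U}:\tilde w(i)\ge\rho\}$; (7) let $\tilde w_{ext}:\Sigma\to\mathbb{R}$ equal $\tilde w(i)$ for $i\in\mathcal{U}$ and an independent $\mathcal{N}(0,\sigma^2)$ sample for $i\in\Sigma\setminus\mathcal{U}$; return $(U,\tilde w_{ext})$.
   Formalization: The novel ℓ∞ sensitivity Δ∞(t) is taken as the least nonnegative bound, so h(t) ≥ 0 for t in [Δ0]; with negative values allowed the claim fails (e.g. all weights −1, h(1) = −1, Δ0 = 1). ''All sets of outputs'' means all measurable sets. *)

(* Defs.v *)
From HB Require Import structures.
From mathcomp Require Import all_boot all_order all_algebra finmap.
From mathcomp Require Import all_classical all_reals all_analysis.

Set Implicit Arguments.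
Unset Strict Implicit.
Unset Printing Implicit Defensive.

Import Order.TTheory GRing.Theory Num.Theory.

Local Open Scope classical_set_scope.
Local Open Scope ring_scope.

Definition Phi (R : realType) (x : R) : R := fine (normal_prob 0 1 `]-oo, x]).

Definition Phi_inv (R : realType) (p : R) : R := xget 0 [set x | Phi x = p].

Section Datasets.
Variables (R : realType) (Sigma : choiceType).

Definition dataset := {fmap nat -> {fset Sigma}}.

Definition items (S : dataset) : {fset Sigma} :=
  \big[fsetU/fset0]_(u : domf S) S u.

Definition add_user (S S' : dataset) : Prop :=
  exists v A, v \notin domf S /\ S' = S.[v <- A]%fmap.

Definition neighboring (S S' : dataset) : Prop :=
  add_user S S' \/ add_user S' S.

Definition bounded_users (D0 : nat) (S : dataset) : Prop :=
  forall u : domf S, (#|` S u| <= D0)%N.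

(* Only the values [ALG S i] with [i \in items S] are ever used: the weight
   vector of [S] is the restriction of [ALG S] to [items S]. *)
Definition weighting := dataset -> Sigma -> R.

Definition novel (S S' : dataset) : {fset Sigma} :=
  (items S' `\` items S)%fset.

Definition l2_sensitivity (ALG : weighting) (D0 : nat) : \bar R :=
  ereal_inf [set d%:E | d in [set d : R |
    forall S S', add_user S S' -> bounded_users D0 S -> bounded_users D0 S' ->
      Num.sqrt (\sum_(i <- items S) (ALG S' i - ALG S i) ^+ 2
                + \sum_(i <- novel S S') ALG S' i ^+ 2) <= d]].

(* As for any sensitivity, the least bound is taken among nonnegative reals.
   This only matters if all novel items get negative weights. Allowing
   negative values there, hence a negative [h], would make the privacy of the
   released noisy weights fail: noise above the threshold on an item that is
   not returned would reveal too often that no user holds the item. *)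
Definition novel_linf_sensitivity (ALG : weighting) (D0 t : nat) : \bar R :=
  ereal_inf [set d%:E | d in [set d : R | 0 <= d /\
    forall S S', add_user S S' -> bounded_users D0 S -> bounded_users D0 S' ->
      #|` novel S S'| = t -> forall i, i \in novel S S' -> ALG S' i <= d]].

Definition output := ({fset Sigma} * (Sigma -> R))%type.

(* Product of the discrete sigma-algebra on finite sets of items with the
   cylinder sigma-algebra on real functions over [Sigma]. *)
Definition output_events : set (set output) :=
  <<s [set O | (exists Q : set {fset Sigma}, O = fst @^-1` Q) \/
               (exists (i : Sigma) (B : set R),
                  measurable B /\ O = [set o : output | B (o.2 i)])] >>.

Definition differentially_private (eps delta : R)
    (M : dataset -> set output -> \bar R) : Prop :=
  forall S S', neighboring S S' -> forall O, output_events O ->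
    (M S O <= (expR eps)%:E * M S' O + delta%:E)%E.

Definition cap_choices (D0 : nat) (A : {fset Sigma}) : {fset {fset Sigma}} :=
  if (D0 <= #|` A|)%N then [fset B in fpowerset A | #|` B| == D0]%fset
  else [fset A]%fset.

Definition mutually_independent (d : measure_display) (Om : measurableType d)
    (P : probability Om R) (I : choiceType) (E : I -> set (set Om)) : Prop :=
  forall (F : {fset I}) (A : I -> set Om), (forall j, j \in F -> E j (A j)) ->
    P (\bigcap_(j in [set` F]) A j) = (\prod_(j <- F) P (A j))%E.

Definition randomness_events (d : measure_display) (Om : measurableType d)
    (S : dataset) (cap : domf S -> Om -> {fset Sigma})
    (Z : Sigma -> Om -> R) (j : domf S + Sigma) : set (set Om) :=
  match j with
  | inl u => [set cap u @^-1` Q | Q in [set: set {fset Sigma}]]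
  | inr i => [set Z i @^-1` B | B in measurable]
  end.

(* A probability space carrying all the random choices of a run on [S]: the
   capped sets of the users and one Gaussian sample per item of the universe,
   which perturbs the weight of an item held after capping and is itself the
   released value of any other item. *)
Record randomness (D0 : nat) (sigma : R) (S : dataset) := Randomness {
  rnd_display : measure_display ;
  rnd_space : measurableType rnd_display ;
  rnd_prob : probability rnd_space R ;
  rnd_cap : domf S -> rnd_space -> {fset Sigma} ;
  rnd_noise : Sigma -> {RV rnd_prob >-> R} ;
  rnd_cap_choices : forall u x, rnd_cap u x \in cap_choices D0 (S u) ;
  rnd_cap_measurable : forall u B, measurable (rnd_cap u @^-1` [set B]) ;
  rnd_cap_uniform : forall u B, B \in cap_choices D0 (S u) ->
    rnd_prob (rnd_cap u @^-1` [set B])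
      = ((#|` cap_choices D0 (S u)|%:R : R)^-1)%:E ;
  rnd_noise_normal : forall i (B : set R), measurable B ->
    rnd_prob (rnd_noise i @^-1` B) = normal_prob 0 sigma B ;
  rnd_independent : mutually_independent rnd_prob
    (randomness_events rnd_cap (fun i => rnd_noise i : _ -> R))
}.

Definition gaussian_noise_level (eps delta sigma : R) : Prop :=
  0 < sigma /\
  Phi ((2 * sigma)^-1 - eps * sigma)
    - expR eps * Phi (- (2 * sigma)^-1 - eps * sigma) <= delta / 2.

Definition threshold_term (delta sigma : R) (h : nat -> R) (t : nat) : R :=
  h t + sigma * Phi_inv ((1 - delta / 2) `^ (t%:R^-1)).

Definition threshold (delta sigma : R) (D0 : nat) (h : nat -> R) : R :=
  \big[Num.max/threshold_term delta sigma h 1]_(1 <= t < D0.+1)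
    threshold_term delta sigma h t.

Definition weight_and_threshold_out (ALG : weighting) (rho : R)
    (C : dataset) (z : Sigma -> R) : output :=
  let noisy i := ALG C i + z i in
  ([fset i in items C | rho <= noisy i]%fset,
   fun i => if i \in items C then noisy i else z i).

Definition capped (S : dataset) (cap : domf S -> {fset Sigma}) : dataset :=
  [fmap u : domf S => cap u]%fmap.

Definition WeightAndThreshold (delta : R) (D0 : nat) (ALG : weighting)
    (h : nat -> R) (sigma : R) (S : dataset) (r : randomness D0 sigma S) :
    set output -> \bar R :=
  fun O => rnd_prob r [set x |
    O (weight_and_threshold_out ALG (threshold delta sigma D0 h)
         (capped (fun u => rnd_cap u x)) (fun i => rnd_noise r i x))].

End Datasets.

(* Main.v *)
Require Import Defs.
From HB Require Import structures.
From mathcomp Require Import all_boot all_order all_algebra finmap.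
From mathcomp Require Import all_classical all_reals all_analysis.
From mathcomp Require Import measurable_realfun ring lra.
Import Order.TTheory GRing.Theory Num.Theory.
Import numFieldNormedType.Exports.
Local Open Scope classical_set_scope.
Local Open Scope ring_scope.

Set Implicit Arguments.
Unset Strict Implicit.
Unset Printing Implicit Defensive.

(** Fix the capped sets of all users, and extend each weight vector by 0 to the
    whole universe. The released function is then the weight vector plus
    standard Gaussian noise scaled by [sigma], and the released set is read off
    that function, in the same way for two neighbouring datasets as long as no
    novel item passes the threshold. This exception costs [delta / 2], because
    the noise of the [t] novel items is independent and the threshold is a
    quantile of their maximum. Off the exception, both runs are the same
    post-processing of two Gaussian mechanisms at distance at most 1.

    The Gaussian mechanism is treated one coordinate at a time on the product
    space [R^Sigma]. Let [g s k] be the hockey-stick divergence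
    [E (1 - k exp (s X - s^2/2))^+] with [X] standard normal. Conditioning on a
    coordinate shifted by [c] replaces [k] by [k exp (c X - c^2/2)], and
    [E g(s, k exp (c X - c^2/2)) = g(sqrt (s^2 + c^2), k)] since [c X + s Y] is
    again Gaussian. Hence only the Euclidean length of the shift matters, and
    for [k = exp eps] the value of [g] is the expression that defines [sigma]. *)

(** * Affine images and densities of normal laws *)

Section lebesgue_affine.
Context {R : realType}.
Local Notation leb := (@lebesgue_measure R).

Definition affine (a s x : R) : R := a + s * x.

Lemma measurable_affine (a s : R) : measurable_fun [set: R] (affine a s).
Proof. by apply: measurable_funD => //; exact: measurable_funM. Qed.

Lemma affine_preimage_itv (a s u v : R) : 0 < s ->
  affine a s @^-1` `]u, v] = `](u - a) / s, (v - a) / s]%classic.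
Proof.
move=> s0; apply/seteqP.
by split => x /=;
  rewrite !in_itv/= ltr_pdivrMr// ler_pdivlMr// ltrBlDl lerBrDl (mulrC x).
Qed.

(** Lebesgue measure is determined by its values on half-open intervals, and the scaled pushforward
    agrees with it there. *)
Lemma lebesgue_measure_affine_gt0 (a s : R) (A : set R) : 0 < s -> measurable A ->
  leb A = (s%:E * leb (affine a s @^-1` A))%E.
Proof.
move=> s0 mA.
pose f' : {mfun measurableTypeR R >-> measurableTypeR R} :=
  HB.pack (affine a s)
    (isMeasurableFun.Build _ _ (measurableTypeR R) (measurableTypeR R) _
       (measurable_affine a s)).
rewrite (@lebesgue_measure_unique _ (mscale (NngNum (ltW s0)) (pushforward leb f'))) //.
move=> _ [[u v]] _ <-.
rewrite /mscale/= /pushforward.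
change (leb `]u, v] = s%:E * leb (affine a s @^-1` `]u, v]))%E.
rewrite affine_preimage_itv// !lebesgue_measure_itv/=.
rewrite !lte_fin ltr_pM2r ?invr_gt0// ltrD2r.
case: ifPn => _; last by rewrite mule0.
by rewrite -!EFinB -EFinM; congr EFin; field; rewrite gt_eqF.
Qed.

(** A negative slope reduces to a positive one: the preimages under slopes [s] and [-s] are
    reflections of each other. *)
Lemma lebesgue_measure_affine (a s : R) (A : set R) : s != 0 -> measurable A ->
  leb A = (`|s|%:E * leb (affine a s @^-1` A))%E.
Proof.
move=> s0 mA; have [sp|sn] := ltP 0 s.
  by rewrite gtr0_norm// -lebesgue_measure_affine_gt0.
have {}sn : s < 0 by rewrite lt_neqAle s0.
rewrite ltr0_norm// (@lebesgue_measure_affine_gt0 a (- s))// ?oppr_gt0//.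
congr (_ * _)%E; rewrite -lebesgue_measureN.
  rewrite /pushforward; congr lebesgue_measure; apply/seteqP.
  by split => x /=; rewrite /affine mulrNN.
by rewrite -[X in measurable X]setTI; exact: measurable_affine.
Qed.

Lemma ge0_integral_affine (a s : R) (f : R -> \bar R) : s != 0 ->
  measurable_fun [set: R] f -> (forall x, (0 <= f x)%E) ->
  (\int[leb]_x f x = \int[leb]_x (`|s|%:E * f (affine a s x)))%E.
Proof.
move=> s0 mf f0.
have maf := measurable_affine a s.
pose f' : {mfun measurableTypeR R >-> measurableTypeR R} :=
  HB.pack (affine a s)
    (isMeasurableFun.Build _ _ (measurableTypeR R) (measurableTypeR R) _ maf).
have sp : 0 <= `|s| by [].
rewrite (eq_measure_integral (mscale (NngNum sp) (pushforward leb f'))); last first.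
  by move=> A mA _; exact: lebesgue_measure_affine.
rewrite ge0_integral_mscale// ge0_integral_pushforward// ge0_integralZl//.
exact: measurableT_comp.
Qed.

End lebesgue_affine.

Section density.
Context d (T : measurableType d) (R : realType).
Variables (nu : {finite_measure set T -> \bar R})
          (mu : {sigma_finite_measure set T -> \bar R}).
Variable (p : T -> R).
Hypotheses (mp : measurable_fun [set: T] p) (p0 : forall x, 0 <= p x).
Hypothesis nuE : forall A, measurable A -> nu A = (\int[mu]_(x in A) (p x)%:E)%E.

(** Integrals against [nu] use its Radon-Nikodym derivative, which agrees almost everywhere with [p]
    because both have the same integral over every measurable set. *)
Lemma ge0_integral_density (f : T -> \bar R) : measurable_fun [set: T] f ->
  (forall x, 0 <= f x)%E -> (\int[nu]_x f x = \int[mu]_x (f x * (p x)%:E))%E.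
Proof.
move=> mf f0.
have numu : nu `<< mu.
  apply/null_content_dominatesP => A mA A0; rewrite nuE//.
  by apply: null_set_integral => //; apply/measurable_funTS/measurable_EFinP.
rewrite -(Radon_Nikodym_SigmaFinite.change_of_variables numu)//.
apply: ae_eq_integral => //.
- apply: emeasurable_funM => //.
  exact: measurable_int (Radon_Nikodym_SigmaFinite.f_integrable numu).
- by apply: emeasurable_funM => //; apply/measurable_EFinP.
- apply: ae_eqe_mul2l; apply: integral_ae_eq => //.
  + exact: Radon_Nikodym_SigmaFinite.f_integrable.
  + exact/measurable_EFinP.
  + by move=> A _ mA; rewrite -Radon_Nikodym_SigmaFinite.f_integral// nuE.
Qed.
End density.

Section normal.
Context {R : realType}.
Local Notation leb := (@lebesgue_measure R).
Local Notation std := (@normal_prob R 0 1).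

Lemma ge0_integral_normal (m s : R) (f : R -> \bar R) : measurable_fun [set: R] f ->
  (forall x, 0 <= f x)%E ->
  (\int[normal_prob m s]_x f x = \int[leb]_x (f x * (normal_pdf m s x)%:E))%E.
Proof.
move=> mf f0; apply: ge0_integral_density => //; exact: measurable_normal_pdf.
Qed.

Lemma normal_pdf_affine (m s x : R) : s != 0 ->
  `|s| * normal_pdf m s (affine m s x) = normal_pdf 0 1 x.
Proof.
move=> s0; rewrite !normal_pdfE ?oner_eq0// /normal_peak /normal_fun /affine.
rewrite mulrA; congr (_ * expR _); last by field; rewrite s0.
rewrite expr1n mul1r -mulrnAr sqrtrM ?sqr_ge0// sqrtr_sqr invfM mulrA divff ?mul1r//.
by rewrite normr_eq0.
Qed.

Lemma ge0_integral_normal_affine (m s : R) (f : R -> \bar R) : s != 0 ->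
  measurable_fun [set: R] f -> (forall x, 0 <= f x)%E ->
  (\int[normal_prob m s]_x f x = \int[std]_x f (affine m s x))%E.
Proof.
move=> s0 mf f0.
have maf := measurable_affine m s.
have mfa : measurable_fun [set: R] (f \o affine m s) := measurableT_comp mf maf.
have -> := @ge0_integral_normal 0 1 _ mfa (fun x => f0 _).
rewrite (ge0_integral_normal m s mf f0).
rewrite (@ge0_integral_affine _ m s) //; last 2 first.
- by apply: emeasurable_funM => //; apply/measurable_EFinP; exact: measurable_normal_pdf.
- by move=> x; rewrite mule_ge0// lee_fin normal_pdf_ge0.
apply: eq_integral => x _; rewrite -(normal_pdf_affine m x s0) EFinM.
by rewrite !muleA (muleC `|s|%:E).
Qed.

Lemma normal_prob_affine (m s : R) (A : set R) : s != 0 -> measurable A ->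
  normal_prob m s A = std (affine m s @^-1` A).
Proof.
move=> s0 mA.
have mA' : measurable (affine m s @^-1` A).
  by rewrite -[X in measurable X]setTI; exact: measurable_affine.
have := @ge0_integral_normal_affine m s (EFin \o \1_A) s0.
rewrite /= integral_indic// setIT => -> //.
  by rewrite -[X in std X]setIT -integral_indic.
by apply/measurable_EFinP; exact: measurable_indic.
Qed.

Lemma normal_pdf_shift (a x : R) :
  normal_pdf a 1 x = expR (a * x - a ^+ 2 / 2) * normal_pdf 0 1 x.
Proof.
rewrite !normal_pdfE ?oner_eq0// mulrCA /normal_fun -expRD; congr (_ * expR _).
by rewrite subr0 expr1n; field.
Qed.

Lemma measurable_expR_affine (a b : R) :
  measurable_fun [set: R] (fun x : R => expR (a * x - b)).
Proof.
apply: measurableT_comp; first exact: measurable_expR.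
by apply: measurable_funB => //; exact: measurable_funM.
Qed.

(* One-dimensional Cameron-Martin formula. *)
Lemma ge0_integral_normal_shift (a : R) (f : R -> \bar R) :
  measurable_fun [set: R] f -> (forall x, 0 <= f x)%E ->
  (\int[std]_x f (x + a)%R = \int[std]_x (f x * (expR (a * x - a ^+ 2 / 2))%:E))%E.
Proof.
move=> mf f0.
transitivity (\int[normal_prob a 1]_x f x)%E.
  rewrite (ge0_integral_normal_affine a (oner_neq0 R) mf f0).
  by apply: eq_integral => x _; rewrite /affine mul1r addrC.
have mfe : measurable_fun [set: R] (fun x => f x * (expR (a * x - a ^+ 2 / 2))%:E)%E.
  by apply: emeasurable_funM => //; apply/measurable_EFinP; exact: measurable_expR_affine.
have fe0 x : (0 <= f x * (expR (a * x - a ^+ 2 / 2))%:E)%E.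
  by rewrite mule_ge0// lee_fin expR_ge0.
rewrite (ge0_integral_normal 0 1 mfe fe0) (ge0_integral_normal a 1 mf f0).
by apply: eq_integral => x _; rewrite normal_pdf_shift EFinM muleA.
Qed.

End normal.

(** * Sums of independent normal variables *)

Section convolution.
Context {R : realType}.
Local Notation leb := (@lebesgue_measure R).
Local Notation std := (@normal_prob R 0 1).

Lemma normal_pdf_abs (m s : R) : normal_pdf m `|s| = normal_pdf m s.
Proof.
by rewrite /normal_pdf /normal_peak /normal_fun real_normK ?num_real// normr_eq0.
Qed.

Lemma ge0_integral_normal_scale (s : R) (f : R -> \bar R) : s != 0 ->
  measurable_fun [set: R] f -> (forall x, 0 <= f x)%E ->
  (\int[std]_x f (s * x)%R = \int[leb]_x (f x * (normal_pdf 0 s x)%:E))%E.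
Proof.
move=> s0 mf f0; rewrite -(ge0_integral_normal 0 s mf f0).
rewrite (ge0_integral_normal_affine 0 s0 mf f0).
by apply: eq_integral => x _; rewrite /affine add0r.
Qed.

(** Symmetry of the normal law: its density sees [s] only through [s ^+ 2]. The absolute value
    appears below as [Num.sqrt (c ^+ 2)]. *)
Lemma ge0_integral_normal_scale_abs (s : R) (f : R -> \bar R) :
  measurable_fun [set: R] f -> (forall x, 0 <= f x)%E ->
  (\int[std]_x f (s * x)%R = \int[std]_x f (`|s| * x)%R)%E.
Proof.
move=> mf f0; have [->|s0] := eqVneq s 0; first by rewrite normr0.
have s0' : `|s| != 0 by rewrite normr_eq0.
rewrite (ge0_integral_normal_scale s0 mf f0) (ge0_integral_normal_scale s0' mf f0).
by rewrite normal_pdf_abs.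
Qed.

(** Two factorizations of the joint density of [X] and [U = c X + d Y], for independent standard
    normal [X] and [Y]: the law of [X] times that of [U] given [X], and the law of [U] times that of
    [X] given [U]. *)
Lemma normal_pdf_mul (c d k x u : R) : d != 0 -> 0 < k -> k ^+ 2 = c ^+ 2 + d ^+ 2 ->
  normal_pdf (c * x) d u * normal_pdf 0 1 x =
  normal_pdf 0 k u * normal_pdf (c * u / k ^+ 2) (d / k) x.
Proof.
move=> d0 k0 kE; have k0' : k != 0 by rewrite gt_eqF.
rewrite !normal_pdfE ?oner_eq0 ?mulf_neq0 ?invr_eq0// /normal_fun.
rewrite mulrACA [RHS]mulrACA -!expRD; congr (_ * expR _).
  have p0 (a : R) : 0 <= a ^+ 2 * pi *+ 2 by rewrite mulrn_wge0// mulr_ge0 ?pi_ge0 ?sqr_ge0.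
  rewrite /normal_peak -!invfM -!sqrtrM ?p0//.
  by congr (Num.sqrt _)^-1; field; rewrite k0'.
have : d ^+ 2 != 0 by rewrite sqrf_eq0.
have : k ^+ 2 != 0 by rewrite sqrf_eq0.
rewrite expr_div_n kE expr1n; move: (d ^+ 2) => D cD0 D0.
by field; rewrite D0 cD0.
Qed.

Lemma measurable_normal_pdf2 (c d : R) : d != 0 ->
  measurable_fun [set: R * R] (fun z : R * R => normal_pdf (c * z.1) d z.2).
Proof.
move=> d0; rewrite (_ : (fun z => _) =
    (fun z : R * R => normal_peak d * expR (- (z.2 - c * z.1) ^+ 2 / (d ^+ 2 *+ 2)))); last first.
  by apply/funext => z; rewrite normal_pdfE.
apply: measurable_funM => //; apply: measurableT_comp => //.
apply: measurable_funM => //; apply: measurableT_comp => //.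
apply: measurable_funX; apply: measurable_funB => //.
by apply: measurable_funM.
Qed.

(* For [c, d != 0], exchanging the integrals and completing the square. *)
Lemma ge0_integral_normal_convolution_neq0 (c d : R) (f : R -> \bar R) :
  c != 0 -> d != 0 ->
  measurable_fun [set: R] f -> (forall x, 0 <= f x)%E ->
  (\int[std]_x \int[std]_y f (c * x + d * y)%R =
   \int[std]_x f (Num.sqrt (c ^+ 2 + d ^+ 2) * x)%R)%E.
Proof.
move=> c0 d0 mf f0; set k := Num.sqrt _.
have k0 : 0 < k by rewrite sqrtr_gt0 ltr_wpDr ?sqr_ge0// lt0r sqrf_eq0 c0 sqr_ge0.
have kE : k ^+ 2 = c ^+ 2 + d ^+ 2 by rewrite sqr_sqrtr// addr_ge0 ?sqr_ge0.
have k0' : k != 0 by rewrite gt_eqF.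
rewrite (ge0_integral_normal_scale k0' mf f0).
pose F (z : R * R) := (f z.2 * (normal_pdf (c * z.1) d z.2 * normal_pdf 0 1 z.1)%:E)%E.
have mF : measurable_fun [set: R * R] F.
  apply: emeasurable_funM; first exact: measurableT_comp.
  apply/measurable_EFinP/measurable_funM; first exact: measurable_normal_pdf2.
  by apply: measurableT_comp => //; exact: measurable_normal_pdf.
have F0 z : (0 <= F z)%E by rewrite mule_ge0// lee_fin mulr_ge0// normal_pdf_ge0.
pose G x := (\int[leb]_u (f u * (normal_pdf (c * x) d u)%:E))%E.
have GE x : (\int[std]_y f (c * x + d * y)%R = G x)%E.
  rewrite /G -(ge0_integral_normal (c * x) d mf f0).
  by rewrite (ge0_integral_normal_affine (c * x) d0 mf f0).
have mpdf m s : measurable_fun [set: R] (fun u => (normal_pdf m s u)%:E).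
  by apply/measurable_EFinP; exact: measurable_normal_pdf.
have G0 x : (0 <= G x)%E.
  by apply: integral_ge0 => u _; rewrite mule_ge0// lee_fin normal_pdf_ge0.
have mG : measurable_fun [set: R] G.
  pose H (z : R * R) := (f z.2 * (normal_pdf (c * z.1) d z.2)%:E)%E.
  apply: (@measurable_fun_fubini_tonelli_F _ _ _ _ _ leb H).
    apply: emeasurable_funM; first exact: measurableT_comp.
    by apply/measurable_EFinP; exact: measurable_normal_pdf2.
  by move=> z; rewrite mule_ge0// lee_fin normal_pdf_ge0.
under eq_integral do rewrite GE.
rewrite (ge0_integral_normal 0 1 mG G0).
transitivity (\int[leb]_x \int[leb]_u F (x, u))%E.
  apply: eq_integral => x _; rewrite /G -ge0_integralZr//.
  - by apply: eq_integral => u _; rewrite /F/= EFinM muleA.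
  - by apply: emeasurable_funM => //; exact: mpdf.
  - by move=> u _; rewrite mule_ge0// lee_fin normal_pdf_ge0.
  - by rewrite lee_fin normal_pdf_ge0.
rewrite (@fubini_tonelli _ _ _ _ _ leb leb F mF F0).
apply: eq_integral => u _.
transitivity (\int[leb]_x ((f u * (normal_pdf 0 k u)%:E) *
                           (normal_pdf (c * u / k ^+ 2) (d / k) x)%:E))%E.
  by apply: eq_integral => x _; rewrite /F/= (@normal_pdf_mul _ _ k)// EFinM muleA.
(* The remaining integral over [x] is that of a conditional density, hence 1. *)
rewrite ge0_integralZl//; first by rewrite integral_normal_pdf mule1.
- exact: mpdf.
- by move=> x _; rewrite lee_fin normal_pdf_ge0.
- by rewrite mule_ge0// lee_fin normal_pdf_ge0.
Qed.

Lemma ge0_integral_normal_cst (c : \bar R) : (\int[std]_x c = c)%E.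
Proof. by rewrite integral_cst// [X in (_ * X)%E]probability_setT mule1. Qed.

(** If a coefficient vanishes, one of the two integrals is over a constant and symmetry absorbs the
    sign of the other coefficient. *)
Lemma ge0_integral_normal_convolution (c d : R) (f : R -> \bar R) :
  measurable_fun [set: R] f -> (forall x, 0 <= f x)%E ->
  (\int[std]_x \int[std]_y f (c * x + d * y)%R =
   \int[std]_x f (Num.sqrt (c ^+ 2 + d ^+ 2) * x)%R)%E.
Proof.
move=> mf f0; have [->|c0] := eqVneq c 0.
  rewrite expr0n add0r sqrtr_sqr -(ge0_integral_normal_scale_abs d mf f0).
  rewrite -[RHS]ge0_integral_normal_cst; apply: eq_integral => x _.
  by apply: eq_integral => y _; rewrite mul0r add0r.
have [->|d0] := eqVneq d 0; last exact: ge0_integral_normal_convolution_neq0.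
rewrite expr0n addr0 sqrtr_sqr -(ge0_integral_normal_scale_abs c mf f0).
apply: eq_integral => x _; rewrite -[RHS]ge0_integral_normal_cst.
by apply: eq_integral => y _; rewrite mul0r addr0.
Qed.

End convolution.

(** * Hockey-stick divergence of shifted Gaussians *)

(* Locked: otherwise unification unfolds the density of [normal_prob]. *)
HB.lock Definition gauss (R : realType) : probability (measurableTypeR R) R :=
  normal_prob 0 1.

Section gauss.
Context {R : realType}.
Local Notation N := (gauss R).

Lemma gaussE : N = normal_prob 0 1 :> (set R -> \bar R).
Proof. by rewrite unlock. Qed.

Lemma ge0_integral_gauss_shift (a : R) (f : R -> \bar R) :
  measurable_fun [set: R] f -> (forall x, 0 <= f x)%E ->
  (\int[N]_x f (x + a)%R = \int[N]_x (f x * (expR (a * x - a ^+ 2 / 2))%:E))%E.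
Proof. rewrite unlock; exact: ge0_integral_normal_shift. Qed.

Lemma ge0_integral_gauss_convolution (c d : R) (f : R -> \bar R) :
  measurable_fun [set: R] f -> (forall x, 0 <= f x)%E ->
  (\int[N]_x \int[N]_y f (c * x + d * y)%R =
   \int[N]_x f (Num.sqrt (c ^+ 2 + d ^+ 2) * x)%R)%E.
Proof. rewrite unlock; exact: ge0_integral_normal_convolution. Qed.

Lemma integral_gauss_cst (c : \bar R) : (\int[N]_x c = c)%E.
Proof. by rewrite integral_cst// [X in (_ * X)%E]probability_setT mule1. Qed.

Lemma PhiE (x : R) : (Phi x)%:E = N `]-oo, x]%classic.
Proof. by rewrite /Phi -gaussE fineK// fin_num_measure. Qed.

(** The exponential is the density of the normal law of mean [s] with respect to the standard one.
    For [k >= 0] the integral is thus the largest excess of the standard measure of a set over [k]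
    times its shifted measure. *)
Definition hockey_stick (s k : R) : \bar R :=
  \int[N]_x (Num.max (1 - k * expR (s * x - s ^+ 2 / 2)) 0)%:E.

Lemma hockey_stick_ge0 (s k : R) : (0 <= hockey_stick s k)%E.
Proof. by apply: integral_ge0 => x _; rewrite lee_fin le_max lexx orbT. Qed.

Lemma measurable_hockey_stick (s : R) : measurable_fun [set: R] (hockey_stick s).
Proof.
pose F (z : R * R) := (Num.max (1 - z.1 * expR (s * z.2 - s ^+ 2 / 2)) 0)%:E.
apply: (@measurable_fun_fubini_tonelli_F _ _ _ _ _ N F).
  apply/measurable_EFinP/measurable_maxr => //.
  apply: measurable_funB => //; apply: measurable_funM => //.
  apply: (measurableT_comp (measurable_expR_affine s (s ^+ 2 / 2))).
  exact: measurable_snd.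
by move=> z; rewrite lee_fin le_max lexx orbT.
Qed.

(* A Gaussian privacy loss of variance [s ^+ 2] followed by an independent one
   of variance [c ^+ 2] is one of variance [s ^+ 2 + c ^+ 2]. *)
Lemma hockey_stick_mix (s c k : R) :
  (\int[N]_x hockey_stick s (k * expR (c * x - c ^+ 2 / 2)) =
   hockey_stick (Num.sqrt (c ^+ 2 + s ^+ 2)) k)%E.
Proof.
set t := Num.sqrt _.
have tE : t ^+ 2 = c ^+ 2 + s ^+ 2 by rewrite sqr_sqrtr// addr_ge0 ?sqr_ge0.
(* With the drift fixed at [t ^+ 2 / 2], both sides become integrals of [f], evaluated at
   [c x + s y] on one side and at [t x] on the other. *)
pose f u := (Num.max (1 - k * expR (1 * u - t ^+ 2 / 2)) 0)%:E.
have mf : measurable_fun [set: R] f.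
  apply/measurable_EFinP/measurable_maxr => //.
  apply: measurable_funB => //; apply: measurable_funM => //.
  exact: measurable_expR_affine.
have f0 u : (0 <= f u)%E by rewrite lee_fin le_max lexx orbT.
transitivity (\int[N]_x f (t * x)%R)%E; last first.
  by apply: eq_integral => x _; rewrite /f mul1r.
rewrite -(ge0_integral_gauss_convolution c s mf f0); apply: eq_integral => x _.
apply: eq_integral => y _; rewrite /f -mulrA -expRD.
by congr (Num.max (1 - k * expR _) 0)%:E; rewrite tE; field.
Qed.

(** A density has total mass 1: this is the Cameron-Martin formula for the constant function 1. *)
Lemma integral_gauss_expR (s : R) : (\int[N]_x (expR (s * x - s ^+ 2 / 2))%:E = 1)%E.
Proof.
rewrite -[RHS]integral_gauss_cst (@ge0_integral_gauss_shift s (cst 1%E))//.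
by apply: eq_integral => x _; rewrite mul1e.
Qed.

Lemma measurable_hockey_stick_integrand (s k : R) : measurable_fun [set: R]
  (fun x => (Num.max (1 - k * expR (s * x - s ^+ 2 / 2)) 0)%:E).
Proof.
apply/measurable_EFinP/measurable_maxr => //.
apply: measurable_funB => //; apply: measurable_funM => //.
exact: measurable_expR_affine.
Qed.

Lemma measurable_expRZ (s k : R) : measurable_fun [set: R]
  (fun x => (k * expR (s * x - s ^+ 2 / 2))%:E).
Proof.
by apply/measurable_EFinP/measurable_funM => //; exact: measurable_expR_affine.
Qed.

(** The positive part dominates its argument, whose mean is [1 - k]. The proof integrates the
    equivalent inequality between nonnegative functions, so that no difference of integrals
    occurs. *)
Lemma hockey_stick_ge (s k : R) : 0 <= k -> ((1 - k)%:E <= hockey_stick s k)%E.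
Proof.
move=> k0; rewrite EFinB leeBlDr// -[leLHS]integral_gauss_cst.
rewrite -[X in (_ + X)%E]mule1 -[X in (_ + _ * X)%E](integral_gauss_expR s).
have me : measurable_fun [set: R] (fun x => (expR (s * x - s ^+ 2 / 2))%:E).
  by apply/measurable_EFinP; exact: measurable_expR_affine.
have e0 (x : R) : (0 <= (expR (s * x - s ^+ 2 / 2))%:E)%E by rewrite lee_fin expR_ge0.
rewrite -(@ge0_integralZl _ _ _ N _ measurableT _ me k%:E (fun x _ => e0 x))//.
have mh := measurable_hockey_stick_integrand s k.
have h0 (x : R) : (0 <= (Num.max (1 - k * expR (s * x - s ^+ 2 / 2)) 0)%:E)%E.
  by rewrite lee_fin le_max lexx orbT.
have mke : measurable_fun [set: R] (fun x => k%:E * (expR (s * x - s ^+ 2 / 2))%:E)%E.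
  exact: measurable_expRZ.
have ke0 (x : R) : (0 <= k%:E * (expR (s * x - s ^+ 2 / 2))%:E)%E.
  by rewrite -EFinM lee_fin mulr_ge0// expR_ge0.
rewrite -(@ge0_integralD _ _ _ N _ measurableT _ _
  (fun x _ => h0 x) mh (fun x _ => ke0 x) mke).
apply: ge0_le_integral => //.
- exact: emeasurable_funD.
- by move=> x _; rewrite -EFinM -EFinD lee_fin -lerBlDr le_max lexx.
Qed.

(* The integrand is positive exactly on a half-line, where both of its terms
   integrate to values of [Phi]. *)
Lemma hockey_stick_expR (s e : R) : 0 < s ->
  (hockey_stick s (expR e) + (expR e * Phi (- (s / 2) - e / s))%:E =
   (Phi (s / 2 - e / s))%:E)%E.
Proof.
(* [c] is the point where the likelihood ratio times [expR e] equals 1; the integrand is positive to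
   its left. *)
move=> s0; set c := s / 2 - e / s.
have -> : - (s / 2) - e / s = c - s by rewrite /c; field; rewrite gt_eqF.
rewrite EFinM !PhiE.
have mA (a : R) : measurable (`]-oo, a]%classic : set R) by [].
have -> : N `]-oo, c - s]%classic = (\int[N]_x (\1_`]-oo, c] (x + s)%R)%:E)%E.
  rewrite -[X in N X]setIT -integral_indic//.
  apply: eq_integral => x _; rewrite !indicE; congr ((nat_of_bool _)%:R%:E).
  by rewrite !mem_setE !in_itv/= lerBrDr.
have mi : measurable_fun [set: R] (fun x => (\1_`]-oo, c]%classic x)%:E : \bar R).
  by apply/measurable_EFinP; exact: measurable_indic.
have i0 (x : R) : (0 <= (\1_`]-oo, c]%classic x)%:E :> \bar R)%E by rewrite lee_fin.
rewrite (@ge0_integral_gauss_shift s (fun x => (\1_`]-oo, c]%classic x)%:E) mi i0).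
have mie : measurable_fun [set: R]
    (fun x => (\1_`]-oo, c]%classic x)%:E * (expR (s * x - s ^+ 2 / 2))%:E)%E.
  apply: emeasurable_funM => //.
  by apply/measurable_EFinP; exact: measurable_expR_affine.
have ie0 (x : R) : (0 <= (\1_`]-oo, c]%classic x)%:E * (expR (s * x - s ^+ 2 / 2))%:E)%E.
  by rewrite mule_ge0// lee_fin expR_ge0.
have k0 : (0 <= (expR e)%:E)%E by rewrite lee_fin expR_ge0.
rewrite -(@ge0_integralZl _ _ _ N _ measurableT _ mie (expR e)%:E (fun x _ => ie0 x))//.
have mh := measurable_hockey_stick_integrand s (expR e).
have h0 (x : R) : (0 <= (Num.max (1 - expR e * expR (s * x - s ^+ 2 / 2)) 0)%:E)%E.
  by rewrite lee_fin le_max lexx orbT.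
have mkie := measurable_funeM (expR e)%:E mie.
have kie0 (x : R) := mule_ge0 k0 (ie0 x).
rewrite -(@ge0_integralD _ _ _ N _ measurableT _ _
  (fun x _ => h0 x) mh (fun x _ => kie0 x) mkie).
rewrite -[X in N X]setIT -integral_indic//.
apply: eq_integral => x _.
rewrite -!EFinM -EFinD indicE -expRD; congr EFin.
have -> : (x \in (`]-oo, c]%classic : set R)) = (e + (s * x - s ^+ 2 / 2) <= 0).
  rewrite mem_setE in_itv/=.
  have cE : s * c = s ^+ 2 / 2 - e by rewrite /c; field; rewrite gt_eqF.
  by rewrite -(ler_pM2l s0) cE; apply/idP/idP; lra.
have [le0|gt0] := leP.
  rewrite max_l; first by rewrite mulr1n mul1r -expRD subrK.
  by rewrite subr_ge0 -[leRHS]expR0 ler_expR.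
rewrite max_r; first by rewrite mul0r mulr0 addr0.
by rewrite subr_le0 -[leLHS]expR0 ler_expR ltW.
Qed.

End gauss.

(** * The Gaussian quantile *)

Section Phi.
Context {R : realType}.
Local Notation leb := (@lebesgue_measure R).
Local Notation N := (gauss R).

Lemma gauss_set1 (a : R) : N [set a] = 0%E.
Proof.
rewrite gaussE; have /null_content_dominatesP := @normal_prob_dominates R 0 1.
by apply => //; exact: lebesgue_measure_set1.
Qed.

Lemma gauss_itvNyo (a : R) : N `]-oo, a[%classic = (Phi a)%:E.
Proof.
rewrite PhiE -(@setUitv1 _ R -oo%O a true)// measureU//.
  by rewrite [X in (_ + X)%E]gauss_set1 adde0.
apply/disj_set2P; apply/disj_setPS => z /= [].
by rewrite in_itv/= => za zE; rewrite zE ltxx in za.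
Qed.

Lemma Phi_le (x y : R) : x <= y -> Phi x <= Phi y.
Proof.
move=> xy; rewrite -lee_fin !PhiE le_measure ?inE//.
by move=> z /=; rewrite !in_itv/= => /le_trans; exact.
Qed.

(** The Lipschitz constant is the maximum of the standard normal density. *)
Lemma Phi_lipschitz (x y : R) : x <= y -> Phi y - Phi x <= normal_peak 1 * (y - x).
Proof.
move=> xy; rewrite -lee_fin EFinB !PhiE.
have -> : (`]-oo, y] = `]-oo, x] `|` `]x, y] :> set R)%classic.
  by rewrite -itv_bndbnd_setU// bnd_simp.
rewrite measureU//; last first.
  apply/disj_set2P; apply/disj_setPS => z /= [].
  by rewrite !in_itv/= => zx /andP[xz _]; rewrite ltNge zx in xz.
rewrite [X in (X - _)%E]addeC addeK ?fin_num_measure//.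
rewrite [leLHS](_ : _ = normal_prob 0 1 `]x, y]%classic); last by rewrite -gaussE.
rewrite /normal_prob.
have mp : measurable_fun (`]x, y]%classic : set R) (EFin \o normal_pdf 0 1).
  by apply/measurable_EFinP/measurable_funTS; exact: measurable_normal_pdf.
apply: (@le_trans _ _ (\int[leb]_(z in `]x, y]) (normal_peak 1)%:E)%E).
  apply: ge0_le_integral => //.
  - by move=> z _; rewrite lee_fin normal_pdf_ge0.
  - by move=> z _; rewrite lee_fin normal_pdf_ub// oner_eq0.
rewrite integral_cst//= lebesgue_measure_itv/= lte_fin.
case: ifPn => _; first by rewrite -EFinB -EFinM.
by rewrite mule0 lee_fin mulr_ge0 ?normal_peak_ge0 ?subr_ge0.
Qed.

Lemma continuous_Phi : continuous (@Phi R).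
Proof.
have k0 : 0 < normal_peak (1 : R) by rewrite normal_peak_gt0// oner_eq0.
have lip (x y : R) : `|Phi x - Phi y| <= normal_peak 1 * `|x - y|.
  have [xy|/ltW yx] := leP x y.
    rewrite distrC (distrC x) (ger0_norm (_ : 0 <= y - x)) ?subr_ge0//.
    by rewrite ger0_norm ?subr_ge0; [exact: Phi_lipschitz|exact: Phi_le].
  rewrite (ger0_norm (_ : 0 <= x - y)) ?subr_ge0//.
  by rewrite ger0_norm ?subr_ge0; [exact: Phi_lipschitz|exact: Phi_le].
move=> x; apply/cvgrPdist_le => e e0; near=> y.
rewrite (le_trans (lip x y))// -ler_pdivlMl//; near: y.
by apply: cvgr_dist_le => //; rewrite mulr_gt0// invr_gt0.
Unshelve. all: by end_near. Qed.

(** Intermediate value theorem: [Phi] is continuous and tends to 0 and 1 at the two ends. *)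
Lemma Phi_surj (p : R) : 0 < p < 1 -> exists x, Phi x = p.
Proof.
move=> /andP[p0 p1].
(* The identity is a random variable with distribution function [Phi], which gives access to the
   limits of [cdf]. *)
pose X : {RV N >-> R} := HB.pack (idfun : measurableTypeR R -> R)
  (isMeasurableFun.Build _ _ _ _ (idfun : measurableTypeR R -> R) (@measurable_id _ _ setT)).
have XE x : fine (cdf X x) = Phi x by rewrite /Phi -gaussE.
have [a ap] : exists a, Phi a < p.
  have /fine_cvg/cvgr_lt/(_ _ p0) := cvg_cdfNy0 X.
  (* The limit provides a bound valid strictly below [M], hence the witness [M - 1]. *)
  move=> [M [_ /(_ (M - 1))]]; rewrite gtrBl ltr01 => /(_ isT).
  by rewrite /= XE; exists (M - 1).
have [b pb] : exists b, p < Phi b.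
  have /fine_cvg/cvgr_gt/(_ _ p1) := cvg_cdfy1 X.
  move=> [M [_ /(_ (M + 1))]]; rewrite ltrDl ltr01 => /(_ isT).
  by rewrite /= XE; exists (M + 1).
have ab : a <= b.
  by rewrite leNgt; apply/negP => /ltW /Phi_le; rewrite leNgt (lt_trans ap).
have [//| |c _ cE] := @IVT _ (@Phi R) a b p ab.
- by apply: continuous_subspaceT; exact: continuous_Phi.
- by rewrite min_l ?Phi_le// max_r ?Phi_le// !ltW.
by exists c.
Qed.

(** Surjectivity onto the open interval rules out the default value 0 in [Phi_inv]. *)
Lemma Phi_invK (p : R) : 0 < p < 1 -> Phi (Phi_inv p) = p.
Proof.
by move=> /Phi_surj[x xE]; rewrite /Phi_inv; case: xgetP => [y _ //|/(_ x)].
Qed.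

End Phi.

(** * Gaussian families on product spaces *)

Section rectangles.
Context {R : realType} {I : choiceType}.

Definition rectangle (F : {fset I}) (B : I -> set R) : set (I -> R) :=
  [set z | forall i, i \in F -> B i (z i)].

Definition rectangles : set (set (I -> R)) :=
  [set rectangle B.1 B.2 | B in [set B : {fset I} * (I -> set R) |
     forall i, measurable (B.2 i)]].

Definition cylinders := g_sigma_algebraType rectangles.

Lemma measurable_coord (i : I) : measurable_fun [set: cylinders] (fun z : cylinders => z i).
Proof.
move=> _ B mB; rewrite setTI; apply: sub_sigma_algebra.
exists ([fset i]%fset, fun=> B) => //=; apply/seteqP; split => z /=.
  by apply; rewrite inE.
by move=> Bz j; rewrite inE => /eqP ->.
Qed.

Lemma bigcap_fset_measurable d (T : measurableType d) (F : {fset I}) (A : I -> set T) :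
  (forall i, i \in F -> measurable (A i)) -> measurable [set x | forall i, i \in F -> A i x].
Proof.
move=> mA; rewrite (_ : [set x | _] = \big[setI/setT]_(i <- F) A i).
  by rewrite big_seq; apply: big_ind => //; exact: measurableI.
apply/seteqP; split => x /=; last first.
  by rewrite -bigcap_fset => Ax i iF; exact: Ax.
by move=> Ax; rewrite -bigcap_fset => i /= iF; exact: Ax.
Qed.

Lemma measurable_fun_cylinders d (T : measurableType d) (f : T -> cylinders) :
  (forall i, measurable_fun [set: T] (fun x => f x i)) -> measurable_fun [set: T] f.
Proof.
move=> mf; apply: (@measurability _ _ _ cylinders setT f rectangles) => //.
move=> _ [_ [[F B] /= mB <-] <-]; rewrite setTI.
rewrite (_ : _ @^-1` _ = [set x | forall i, i \in F -> ((fun x => f x i) @^-1` B i) x])//.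
by apply: bigcap_fset_measurable => i _; rewrite -[X in measurable X]setTI; exact: mf.
Qed.

Lemma rectanglesI : setI_closed rectangles.
Proof.
move=> _ _ [[F B] /= mB <-] [[F' B'] /= mB' <-].
(* A side that does not constrain coordinate [i] contributes the whole line, so a single family
   serves the union of the two index sets. *)
pose C i := (if i \in F then B i else setT) `&` (if i \in F' then B' i else setT).
exists ((F `|` F')%fset, C) => /=.
  by move=> i; apply: measurableI; case: ifP.
apply/seteqP; split => z /=.
  move=> Cz; split => i iF.
    by have [] := Cz i; rewrite ?inE ?iF// /C iF.
  by have [] := Cz i; rewrite ?inE ?iF ?orbT// /C iF.
move=> [Bz B'z] i _; rewrite /C; split; case: ifP => //; [exact: Bz|exact: B'z].
Qed.

Lemma rectangle0 (B : I -> set R) : rectangle fset0 B = setT.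
Proof. by apply/seteqP; split => z // _ i; rewrite inE. Qed.

(** The rectangles are closed under intersection, contain the whole space and generate the
    sigma-algebra, so finite measures are determined by them. *)
Lemma cylinders_measure_unique (m1 m2 : {measure set cylinders -> \bar R}) :
  (m1 setT < +oo)%E ->
  (forall F B, (forall i, measurable (B i)) -> m1 (rectangle F B) = m2 (rectangle F B)) ->
  forall E, measurable E -> m1 E = m2 E.
Proof.
move=> m1oo m12 E mE.
apply: (@g_sigma_algebra_measure_unique _ R cylinders rectangles _ (fun=> setT)) => //.
- exact: sub_sigma_algebra.
- by move=> _; exists (fset0, fun=> setT) => //=; rewrite rectangle0.
- by rewrite bigcup_const.
- exact: rectanglesI.
- by move=> _ [[F B] /= mB <-]; exact: m12.
Qed.

End rectangles.
Arguments cylinders : clear implicits.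

Section gaussian_family.
Context {R : realType} {I : choiceType}.
Local Notation N := (gauss R).
Local Notation T := (cylinders R I).
Implicit Types (z : T) (v : I -> R).

(** The law of independent standard normal coordinates, described by its finite-dimensional
    marginals; the index type may be infinite. *)
Definition gaussian_family (m : set T -> \bar R) : Prop :=
  forall F (B : I -> set R), (forall i, measurable (B i)) ->
    m (rectangle F B) = (\prod_(i <- F) N (B i))%E.

Definition set_coord (i : I) (x : R) (z : T) : T := fun j => if j == i then x else z j.

Definition shift (s : seq I) v z : T := fun j => if j \in s then z j + v j else z j.

Lemma measurable_set_coord2 (i : I) :
  measurable_fun [set: measurableTypeR R * T] (fun xz => set_coord i xz.1 xz.2).
Proof.
apply: measurable_fun_cylinders => j; rewrite /set_coord; case: eqP => _.
  exact: measurable_fst.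
by apply: (measurableT_comp (measurable_coord j)); exact: measurable_snd.
Qed.

Lemma measurable_set_coord (i : I) (x : R) : measurable_fun [set: T] (set_coord i x).
Proof.
apply: measurable_fun_cylinders => j; rewrite /set_coord; case: eqP => _ //.
exact: measurable_coord.
Qed.

Lemma measurable_shift s v : measurable_fun [set: T] (shift s v).
Proof.
apply: measurable_fun_cylinders => j; rewrite /shift; case: (j \in s).
  apply: (@measurable_funD _ T R setT (fun z : T => z j) (fun=> v j)) => //.
  exact: measurable_coord.
exact: measurable_coord.
Qed.

Variable mu : probability T R.
Hypothesis mu_gauss : gaussian_family mu.

Lemma measurable_preimage d (X : measurableType d) (f : X -> T) (E : set T) :
  measurable_fun [set: X] f -> measurable E -> measurable (f @^-1` E).
Proof. by move=> mf mE; rewrite -[X in measurable X]setTI; exact: mf. Qed.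

Lemma resample_section (i : I) (E : set T) (x : R) :
  xsection ((fun xz => set_coord i xz.1 xz.2) @^-1` E) x = set_coord i x @^-1` E.
Proof. by apply/seteqP; split => z; rewrite xsectionP. Qed.

(** Replacing one coordinate by a fresh independent normal sample leaves the law unchanged, as is
    checked on rectangles. This allows conditioning on a coordinate without splitting the space into
    a product. *)
Lemma resample (i : I) (E : set T) : measurable E ->
  mu E = (\int[N]_x mu (set_coord i x @^-1` E))%E.
Proof.
move=> mE.
pose f : measurableTypeR R * T -> T := fun xz => set_coord i xz.1 xz.2.
have mf : measurable_fun setT f := measurable_set_coord2 i.
pose f' : {mfun (measurableTypeR R * T)%type >-> T} :=
  HB.pack f (isMeasurableFun.Build _ _ (measurableTypeR R * T)%type T f mf).
transitivity (pushforward (N \x mu)%E f' E); last first.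
  rewrite /pushforward /product_measure1/=; apply: eq_integral => x _ /=.
  by rewrite -resample_section.
apply: cylinders_measure_unique => //; first by rewrite [X in (X < _)%E]probability_setT ltry.
move=> F B mB.
rewrite [RHS](_ : _ =
    (N \x mu)%E ((if i \in F then B i else setT) `*` rectangle (F `\ i)%fset B)); last first.
  congr ((N \x mu)%E _); apply/seteqP; split => -[x z] /=; rewrite /f /set_coord/=.
    move=> FB; split.
      by case: ifPn => // iF; have := FB i iF; rewrite eqxx.
    by move=> j; rewrite !inE => /andP[/negbTE ji jF]; have := FB j jF; rewrite ji.
  move=> [Bx FB] j jF; case: eqP => [jE|/eqP ji].
    by rewrite -jE jF in Bx.
  by apply: FB; rewrite !inE ji.
have mR : measurable (rectangle (F `\ i)%fset B : set T).
  by apply: sub_sigma_algebra; exists ((F `\ i)%fset, B).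
rewrite [RHS]product_measure1E//; last by case: (i \in F); [exact: mB|exact: measurableT].
rewrite [LHS](mu_gauss F mB) [X in (_ = _ * X)%E](mu_gauss (F `\ i)%fset mB).
(* A constrained coordinate [i] contributes its own factor; an unconstrained one contributes the
   mass 1 of the whole line. *)
case: ifPn => iF; first by rewrite (big_fsetD1 i).
by rewrite [X in (_ = X * _)%E]probability_setT mul1e mem_fsetD1.
Qed.

Lemma measurable_section (i : I) (E : set T) : measurable E ->
  measurable_fun [set: R] (fun x => mu (set_coord i x @^-1` E)).
Proof.
move=> mE.
have mE' := measurable_preimage (measurable_set_coord2 i) mE.
have := @measurable_fun_xsection _ _ (measurableTypeR R) T R mu _ mE'.
by apply: eq_measurable_fun => x _ /=; rewrite resample_section.
Qed.

End gaussian_family.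

(** * The Gaussian mechanism *)

Section gaussian_mechanism.
Context {R : realType} {I : choiceType}.
Local Notation N := (gauss R).
Local Notation T := (cylinders R I).
Variable mu : probability T R.
Hypothesis mu_gauss : gaussian_family mu.

Lemma shift_set_coord (i : I) s (v : I -> R) (x : R) (z : T) : i \notin s ->
  shift (i :: s) v (set_coord i x z) = set_coord i (x + v i) (shift s v z).
Proof.
move=> si; apply/funext => j; rewrite /shift /set_coord inE.
by have [->|ji] := eqVneq j i.
Qed.

(* The coordinates of [v] are handled one at a time: conditionally on the
   first one, the induction hypothesis applies with [k] replaced by [k] times
   the likelihood ratio of that coordinate. *)
Lemma gaussian_mechanism_sqrt (s : seq I) (v : I -> R) (c : R) : uniq s ->
  forall (k : R) (E : set T), 0 <= k -> measurable E ->
  (mu E <= k%:E * mu (shift s v @^-1` E)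
           + hockey_stick (Num.sqrt (\sum_(i <- s) v i ^+ 2 + c ^+ 2)) k)%E.
Proof.
elim: s => [_ k E k0 mE|i s ih /= /andP[si us] k E k0 mE].
  have -> : shift [::] v @^-1` E = E by [].
  rewrite big_nil add0r sqrtr_sqr.
  have h := hockey_stick_ge `|c| k0.
  have m1 : (mu E <= 1)%E := probability_le1 mu mE.
  have mf : mu E \is a fin_num by rewrite fin_num_measure.
  (* Without a shift, [mu E - k * mu E] is nonpositive for [k >= 1] and at most [1 - k]
     otherwise. *)
  have [k1|k1] := leP 1 k.
    rewrite -[leLHS]adde0 leeD// ?hockey_stick_ge0// -[leLHS]mul1e.
    by rewrite lee_wpmul2r// lee_fin.
  apply: (@le_trans _ _ (k%:E * mu E + (1 - k)%:E)%E); last by rewrite leeD2l.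
  rewrite -(fineK mf) -EFinM -EFinD lee_fin.
  have : fine (mu E) <= 1 by rewrite -lee_fin fineK.
  by move=> m1'; nra.
pose L x := expR (v i * x - v i ^+ 2 / 2).
set t := Num.sqrt (\sum_(i <- s) v i ^+ 2 + c ^+ 2) in ih.
have -> : Num.sqrt (\sum_(i <- i :: s) v i ^+ 2 + c ^+ 2) = Num.sqrt (v i ^+ 2 + t ^+ 2).
  rewrite big_cons -addrA [t ^+ 2]sqr_sqrtr// addr_ge0 ?sqr_ge0//.
  by apply: sumr_ge0 => j _; exact: sqr_ge0.
have L0 x : 0 <= L x := expR_ge0 _.
have mL : measurable_fun [set: R] L := measurable_expR_affine _ _.
have mshE' : measurable (shift (i :: s) v @^-1` E).
  exact: measurable_preimage (measurable_shift (i :: s) v) mE.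
(* [q x] is the conditional probability of the shifted event when the shifted coordinate [i] has the
   value [x]. Integrating it along [x + v i] gives the shifted probability, and Cameron-Martin turns
   this shift into the factor [L]. *)
pose q x := mu (shift s v @^-1` (set_coord i x @^-1` E)).
have qE x : q x = mu (set_coord i (x - v i) @^-1` (shift (i :: s) v @^-1` E)).
  congr (mu _); apply/seteqP.
  by split => z /=; rewrite shift_set_coord// subrK.
have mq : measurable_fun [set: R] q.
  apply: (eq_measurable_fun
    ((fun x => mu (set_coord i x @^-1` (shift (i :: s) v @^-1` E))) \o
     (fun x => x - v i))).
    by move=> x _; rewrite qE.
  apply: measurableT_comp; first exact: measurable_section.
  exact: measurable_funB.
have q0 x : (0 <= q x)%E by exact: measure_ge0.
have -> : mu (shift (i :: s) v @^-1` E) = (\int[N]_x q (x + v i)%R)%E.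
  rewrite (resample mu_gauss i)//; apply: eq_integral => x _.
  by rewrite qE addrK.
rewrite (ge0_integral_gauss_shift (v i) mq q0) -hockey_stick_mix.
have mqL : measurable_fun [set: R] (fun x => q x * (L x)%:E)%E.
  by apply: emeasurable_funM => //; apply/measurable_EFinP.
have qL0 x : (0 <= q x * (L x)%:E)%E by rewrite mule_ge0 ?lee_fin.
have kE0 : (0 <= k%:E)%E by rewrite lee_fin.
rewrite -(@ge0_integralZl _ _ _ N _ measurableT _ mqL k%:E (fun x _ => qL0 x) kE0).
have mkqL := measurable_funeM k%:E mqL.
have kqL0 x := mule_ge0 kE0 (qL0 x).
have mh : measurable_fun [set: R] (fun x => hockey_stick t (k * L x)).
  apply: measurableT_comp; first exact: measurable_hockey_stick.
  exact: measurable_funM.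
have h0 x : (0 <= hockey_stick t (k * L x))%E := hockey_stick_ge0 _ _.
rewrite -(@ge0_integralD _ _ _ N _ measurableT _ _
  (fun x _ => kqL0 x) mkqL (fun x _ => h0 x) mh).
rewrite (resample mu_gauss i mE).
apply: (@ge0_le_integral _ _ _ N _ measurableT) => //.
- exact: measurable_section.
- exact: emeasurable_funD.
- move=> x _; have mEx := measurable_preimage (measurable_set_coord i x) mE.
  have := ih us (k * L x) _ (mulr_ge0 k0 (L0 x)) mEx.
  by rewrite EFinM muleAC muleA.
Qed.

(** The missing squared length [t ^+ 2 - S] is assigned to the spare parameter [c], so an inequality
    on the length of the shift suffices without monotonicity of [hockey_stick]. *)
Lemma gaussian_mechanism (s : seq I) (v : I -> R) (t : R) : uniq s ->
  0 <= t -> \sum_(i <- s) v i ^+ 2 <= t ^+ 2 ->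
  forall (k : R) (E : set T), 0 <= k -> measurable E ->
  (mu E <= k%:E * mu (shift s v @^-1` E) + hockey_stick t k)%E.
Proof.
move=> us t0 vt k E k0 mE.
set S := \sum_(i <- s) v i ^+ 2 in vt.
have tE : Num.sqrt (S + Num.sqrt (t ^+ 2 - S) ^+ 2) = t.
  by rewrite sqr_sqrtr ?subr_ge0// addrC subrK sqrtr_sqr ger0_norm.
rewrite -tE; exact: gaussian_mechanism_sqrt.
Qed.

End gaussian_mechanism.

(** * Thresholding *)

Section thresholding.
Context {R : realType} {I : choiceType}.
Local Notation N := (gauss R).
Local Notation T := (cylinders R I).
Implicit Types (V F W : {fset I}) (m : I -> R) (O : set (output R I)).

Definition threshold_out (rho : R) V (y : I -> R) : output R I :=
  ([fset i in V | rho <= y i]%fset, y).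

Definition perturb m (sigma : R) (z : T) : I -> R := fun i => m i + sigma * z i.

Lemma measurable_perturb m sigma : measurable_fun [set: T] (perturb m sigma : T -> T).
Proof.
apply: measurable_fun_cylinders => j.
apply: (@measurable_funD _ T R setT (fun=> m j) (fun z : T => sigma * z j)) => //.
apply: (@measurable_funM _ T R setT (fun=> sigma) (fun z : T => z j)) => //.
exact: measurable_coord.
Qed.

(** It is enough to treat the generators of [output_events]. For those on the returned set, only the
    finitely many subsets of [V] can occur. *)
Lemma measurable_threshold_out rho V O : output_events O ->
  measurable [set y : T | O (threshold_out rho V y)].
Proof.
pose f : T -> output R I := threshold_out rho V.
suff /(_ O) : @output_events R I `<=` [set O | measurable (f @^-1` O)] by [].
apply: smallest_sub => /=.
  split => /=.
  - by rewrite preimage_set0.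
  - by move=> A mA; rewrite setTD preimage_setC; exact: measurableC.
  - by move=> A mA; rewrite preimage_bigcup; exact: bigcup_measurable.
move=> _ [[Q ->]|[i [B [mB ->]]]] /=; last first.
  by rewrite -[X in measurable X]setTI; exact: measurable_coord.
have mle i : measurable [set y : T | rho <= y i].
  have -> : [set y : T | rho <= y i] = (fun y : T => y i) @^-1` `[rho, +oo[.
    by apply/seteqP; split => y /=; rewrite in_itv/= andbT.
  by rewrite -[X in measurable X]setTI; exact: measurable_coord.
have meq (W : {fset I}) : measurable [set y : T | [fset i in V | rho <= y i]%fset = W].
  have [WV|WV] := boolP (W `<=` V)%fset; last first.
    rewrite (_ : [set y | _] = set0)//; apply/seteqP; split => // y /= WE.
    by move: WV; rewrite -WE; move/negP; apply; exact: fset_sub.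
  rewrite (_ : [set y | _] = [set y : T | forall i, i \in V ->
    (if i \in W then [set y : T | rho <= y i] else ~` [set y : T | rho <= y i]) y]).
    by apply: bigcap_fset_measurable => i _; case: ifP => _ //; exact: measurableC.
  apply/seteqP; split => y /=.
    by move=> <- i iV; rewrite !inE/= iV/=; case: ifPn => //= /negP.
  move=> h; apply/fsetP => i; rewrite !inE/=.
  have [iV|iV] := boolP (i \in V); last first.
    by apply/esym/negbTE; apply: contra iV; exact: (fsubsetP WV).
  by have := h i iV; case: ifPn => //= _ /negP/negbTE.
rewrite (_ : _ @^-1` _ = \bigcup_(W in [set W | W \in fpowerset V] `&` Q)
    [set y : T | [fset i in V | rho <= y i]%fset = W]); last first.
  apply/seteqP; split => y /=.
    move=> Qy; exists [fset i in V | rho <= y i]%fset => //; split => //=.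
    by rewrite fpowersetE; exact: fset_sub.
  by move=> [W [_ QW] /= WE]; rewrite WE.
apply: fin_bigcup_measurable => //; apply: finite_setIl.
exact: finite_fset.
Qed.

Variable mu : probability T R.
Hypothesis mu_gauss : gaussian_family mu.

(** The complement is a rectangle, so its probability is a product over [F]. By the choice of [rho],
    each factor is at least [(1 - delta / 2)] to the power [1 / #|F|]. *)
Lemma tail_bound (sigma rho delta b : R) F m : 0 < sigma -> 0 < delta < 1 ->
  (forall i, i \in F -> m i <= b) ->
  (F != fset0 -> b + sigma * Phi_inv ((1 - delta / 2) `^ (#|` F|%:R^-1)) <= rho) ->
  (mu [set z | exists2 i, i \in F & (rho <= perturb m sigma z i)%R] <= (delta / 2)%:E)%E.
Proof.
move=> s0 /andP[d0 d1] mb hrho.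
pose B i : set R := `]-oo, (rho - m i) / sigma[%classic.
have mR : measurable (rectangle F B : set T).
  by apply: sub_sigma_algebra; exists (F, B) => //= i; exact: measurable_itv.
have -> : [set z : T | exists2 i, i \in F & rho <= perturb m sigma z i] =
    ~` rectangle F B.
  apply/seteqP; split => z /=.
    move=> [i iF le_rho] /(_ i iF); rewrite /B/= in_itv/= ltr_pdivlMr//.
    by rewrite ltrBrDl mulrC ltNge le_rho.
  move=> /existsNP[i /not_implyP[iF]]; rewrite /B/= in_itv/= ltr_pdivlMr//.
  by rewrite ltrBrDl mulrC => /negP; rewrite -leNgt => le_rho; exists i.
rewrite probability_setC// leeBlDr ?fin_num_measure//.
rewrite (_ : mu _ = (\prod_(i <- F) N (B i))%E); last first.
  by apply: mu_gauss => i; exact: measurable_itv.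
rewrite (eq_bigr (fun i => (Phi ((rho - m i) / sigma))%:E)); last first.
  by move=> i _; rewrite -gauss_itvNyo.
rewrite prodEFin -EFinD lee_fin addrC -lerBlDr.
have [->|F0] := eqVneq F fset0; first by rewrite big_seq_fset0; lra.
set p := (1 - delta / 2) `^ (#|` F|%:R^-1) in hrho.
have t0 : (0 < #|` F|)%N by rewrite cardfs_gt0.
have q0 : 0 < 1 - delta / 2 by lra.
have pX : p ^+ #|` F| = 1 - delta / 2.
  rewrite -powR_mulrn ?powR_ge0// -powRrM mulVf ?powRr1 ?ltW//.
  by rewrite pnatr_eq0 -lt0n.
have p0 : 0 < p by rewrite powR_gt0.
have p1 : p < 1.
  rewrite ltNge; apply/negP => p1.
  have : 1 <= p ^+ #|` F| by rewrite exprn_ege1.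
  by rewrite pX; lra.
rewrite -pX; have -> : p ^+ #|` F| = \prod_(i <- F) p.
  by rewrite big_const_seq count_predT iter_mulr_1.
rewrite big_seq [leRHS]big_seq; apply: ler_prod => i iF.
rewrite (ltW p0)/= -[leLHS](@Phi_invK _ p) ?p0//; apply: Phi_le.
rewrite ler_pdivlMr// lerBrDl mulrC; apply: le_trans (hrho F0).
by rewrite lerD2r mb.
Qed.

(* Off the small event that some item of [F] passes the threshold, the two
   mechanisms are the same post-processing of two Gaussian mechanisms. *)
Lemma threshold_private (eps delta sigma rho : R) V1 V2 F W m1 m2 :
  gaussian_noise_level eps delta sigma ->
  (forall y, (forall i, i \in F -> y i < rho) ->
     threshold_out rho V1 y = threshold_out rho V2 y) ->
  (mu [set z | exists2 i, i \in F & (rho <= perturb m1 sigma z i)%R] <= (delta / 2)%:E)%E ->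
  (forall i, i \notin W -> m1 i = m2 i) ->
  \sum_(i <- W) (m2 i - m1 i) ^+ 2 <= 1 ->
  forall O, output_events O ->
  (mu [set z | O (threshold_out rho V1 (perturb m1 sigma z))] <=
   (expR eps)%:E * mu [set z | O (threshold_out rho V2 (perturb m2 sigma z))]
   + delta%:E)%E.
Proof.
move=> [s0 hs] V12 tail mW msum O mO.
pose G := [set y : T | forall i, i \in F -> y i < rho].
have mG : measurable G.
  pose B (_ : I) : set R := `]-oo, rho[%classic.
  have -> : G = rectangle F B by apply/seteqP; split => y /= h i /h; rewrite /B/= in_itv.
  by apply: sub_sigma_algebra; exists (F, B) => //= i; exact: measurable_itv.
have mO1 := measurable_threshold_out rho V1 mO.
have mO2 := measurable_threshold_out rho V2 mO.
have mpre m (E : set T) : measurable E -> measurable (perturb m sigma @^-1` E).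
  exact: (measurable_preimage (measurable_perturb m sigma)).
(* On [G] the outputs computed with [V1] and [V2] coincide, so this [E], written with [V2], serves
   both runs. *)
pose E := [set y : T | O (threshold_out rho V2 y)] `&` G.
have mE : measurable E by exact: measurableI.
(* The noise in [mu] has unit variance, so the shift is measured in units of [sigma] and has length
   at most [sigma^-1]. *)
pose v i := sigma^-1 * (m2 i - m1 i).
have shE : shift W v @^-1` (perturb m1 sigma @^-1` E) = perturb m2 sigma @^-1` E.
  have pE z : perturb m1 sigma (shift W v z) = perturb m2 sigma z.
    apply/funext => i; rewrite /perturb /shift; case: ifPn => iW; last by rewrite mW.
    by rewrite /v; field; rewrite gt_eqF.
  by apply/seteqP; split => z /=; rewrite pE.
have hmech : (mu (perturb m1 sigma @^-1` E) <=
    (expR eps)%:E * mu (perturb m2 sigma @^-1` E) + (delta / 2)%:E)%E.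
  rewrite -shE.
  have si0 : 0 < sigma^-1 by rewrite invr_gt0.
  have vsum : \sum_(i <- W) v i ^+ 2 <= sigma^-1 ^+ 2.
    under eq_bigr do rewrite exprMn.
    by rewrite -mulr_sumr ler_piMr// sqr_ge0.
  have := gaussian_mechanism mu_gauss (fset_uniq W) (ltW si0) vsum
    (expR_ge0 eps) (mpre m1 E mE).
  move=> /le_trans; apply.
  rewrite leeD2l//.
  (* At [s = sigma^-1] the two values of [Phi] are those in [gaussian_noise_level]. *)
  have := hockey_stick_expR eps si0.
  rewrite invrK -invfM (mulrC sigma) => hE.
  have -> : hockey_stick sigma^-1 (expR eps) = ((Phi ((2 * sigma)^-1 - eps * sigma))%:E
      - (expR eps * Phi (- (2 * sigma)^-1 - eps * sigma))%:E)%E.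
    by rewrite -hE addeK.
  by rewrite -EFinB lee_fin.
have bad : (mu (perturb m1 sigma @^-1` (~` G)) <= (delta / 2)%:E)%E.
  rewrite (_ : _ @^-1` _ =
    [set z | exists2 i, i \in F & rho <= perturb m1 sigma z i])//.
  apply/seteqP; split => z /=.
    by move=> /existsNP[i /not_implyP[iF /negP]]; rewrite -leNgt; exists i.
  by move=> [i iF le_rho] /(_ i iF); rewrite ltNge le_rho.
apply: (@le_trans _ _
  (mu (perturb m1 sigma @^-1` E `|` perturb m1 sigma @^-1` (~` G)))).
  apply: le_measure; rewrite ?inE.
  - exact: mpre mO1.
  - by apply: measurableU; apply: mpre => //; exact: measurableC.
  - move=> z /= Oz; have [Gz|Gz] := pselect (G (perturb m1 sigma z)); last by right.
    by left; split => //=; rewrite -V12.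
apply: le_trans (measureU2 _ _ _) _; [exact: mpre|by apply: mpre; exact: measurableC|].
apply: le_trans (leeD hmech bad) _.
rewrite -addeA -EFinD -splitr leeD2r//; apply: lee_wpmul2l; first by rewrite lee_fin expR_ge0.
by apply: le_measure; rewrite ?inE; [exact: mpre|exact: mpre mO2|move=> z []].
Qed.

End thresholding.

(** * Datasets and their random capping *)

Section datasets.
Context {R : realType} {Sigma : choiceType}.
Implicit Types (S C : dataset Sigma) (ALG : weighting R Sigma).

Lemma itemsP S (i : Sigma) :
  reflect (exists (u : nat) (B : {fset Sigma}), S.[? u]%fmap = Some B /\ i \in B)
    (i \in items S).
Proof.
apply: (iffP (bigfcupP _ _ _ _)).
  move=> [u _ iu]; exists (val u), (S u); split => //.
  by rewrite -Some_fnd.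
move=> [u [B [uB iB]]].
have uS : u \in domf S by rewrite -fndSome uB.
exists [` uS]%fset; first by rewrite mem_index_enum.
by move: uB; rewrite in_fnd => -[->].
Qed.

Lemma items_add S v A (i : Sigma) : v \notin domf S ->
  (i \in items S.[v <- A]%fmap) = (i \in items S) || (i \in A).
Proof.
move=> vS; apply/itemsP/orP.
  move=> [u [B [uB iB]]]; move: uB; rewrite fnd_set; case: eqP => [_ [->]|_ uB]; first by right.
  by left; apply/itemsP; exists u, B.
move=> [/itemsP[u [B [uB iB]]]|iA].
  exists u, B; split => //; rewrite fnd_set; case: eqP => // uv.
  by move: vS; rewrite -uv -fndSome uB.
by exists v, A; rewrite fnd_set eqxx.
Qed.

Definition base_weight ALG C (i : Sigma) : R := if i \in items C then ALG C i else 0.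

(** An item outside [items C] is released as pure noise, which is what weight 0 gives; hence the
    released function has the same formula on the whole universe. *)
Lemma weight_and_threshold_outE ALG rho C (z : Sigma -> R) :
  weight_and_threshold_out ALG rho C z =
  threshold_out rho (items C) (fun i => base_weight ALG C i + z i).
Proof.
rewrite /weight_and_threshold_out /threshold_out /base_weight; congr pair.
  by apply/fsetP => i; rewrite !inE; case: ifPn.
by apply/funext => i; case: ifP => // _; rewrite add0r.
Qed.

Lemma cap_choices_card D0 (A B : {fset Sigma}) :
  B \in cap_choices D0 A -> (#|` B| <= D0)%N.
Proof.
rewrite /cap_choices; case: leqP => h; first by rewrite !inE => /andP[_ /eqP ->].
by rewrite inE => /eqP ->; exact: ltnW.
Qed.

Lemma capped_bounded D0 S (c : domf S -> {fset Sigma}) :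
  (forall u, c u \in cap_choices D0 (S u)) -> bounded_users D0 (capped c).
Proof. by move=> hc u; rewrite ffunE; exact: cap_choices_card (hc _). Qed.

End datasets.

(** * The law of a run as a finite mixture over the capped sets *)

Section randomness.
Context {R : realType} {Sigma : choiceType}.
Variables (D0 : nat) (sigma : R) (S : dataset Sigma) (r : randomness D0 sigma S).
Hypothesis sigma_gt0 : 0 < sigma.
Local Notation N := (gauss R).
Local Notation T := (cylinders R Sigma).
Local Notation P := (rnd_prob r).
Local Notation Om := (rnd_space r).

Definition std_noise (x : Om) : T := fun i => sigma^-1 * rnd_noise r i x.

Lemma measurable_std_noise : measurable_fun [set: Om] std_noise.
Proof.
apply: measurable_fun_cylinders => i; apply: measurable_funM => //.
Qed.

Lemma std_noise_law (i : Sigma) (B : set R) : measurable B ->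
  P (rnd_noise r i @^-1` (affine 0 sigma^-1 @^-1` B)) = N B.
Proof.
move=> mB.
have mB' : measurable (affine 0 sigma^-1 @^-1` B).
  by rewrite -[X in measurable X]setTI; exact: measurable_affine.
have s0 : sigma != 0 by rewrite gt_eqF.
rewrite rnd_noise_normal// (normal_prob_affine 0 s0 mB') gaussE.
congr (normal_prob 0 1 _); apply/seteqP.
by split => x /=; rewrite /affine !add0r mulKf.
Qed.

(** The probability of any one joint choice of capped sets; it is the same for all choices. *)
Definition cap_weight : R := \prod_(u : domf S) (#|` cap_choices D0 (S u)|%:R)^-1.

(** Users and items are the two summands of the index type in [rnd_independent]. The list [U] is
    arbitrary because it is taken empty for the law of the noise and full for the joint law. *)
Lemma caps_noise_independent (U : seq (domf S)) (c : domf S -> {fset Sigma}) F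
    (B : Sigma -> set R) : uniq U ->
  (forall u, c u \in cap_choices D0 (S u)) -> (forall i, measurable (B i)) ->
  P ([set x | forall u, u \in U -> rnd_cap u x = c u] `&` (std_noise @^-1` rectangle F B)) =
  ((\prod_(u <- U) ((#|` cap_choices D0 (S u)|%:R)^-1)%:E) * \prod_(i <- F) N (B i))%E.
Proof.
move=> uU hc mB.
pose J : {fset domf S + Sigma} := [fset j in map inl U ++ map inr F]%fset.
pose A (j : domf S + Sigma) : set Om := match j with
  | inl u => rnd_cap u @^-1` [set c u]
  | inr i => rnd_noise r i @^-1` (affine 0 sigma^-1 @^-1` B i) end.
have JA j : j \in J -> randomness_events (rnd_cap (r := r))
    (fun i => rnd_noise r i : _ -> R) j (A j).
  case: j => [u|i] _ /=; first by exists [set c u].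
  exists (affine 0 sigma^-1 @^-1` B i) => //.
  by rewrite -[X in measurable X]setTI; exact: measurable_affine.
have Jperm : perm_eq J (map inl U ++ map inr F).
  apply: uniq_perm; [exact: fset_uniq| |].
    rewrite cat_uniq !map_inj_uniq ?fset_uniq ?uU//=; try by move=> ? ? [].
    by rewrite andbT; apply/hasPn => _ /mapP[i _ ->]; apply/mapP => -[].
  by move=> j; apply/imfsetP/idP => [[k /= kJ ->]//|jJ]; exists j.
have JE : \bigcap_(j in [set` J]) A j =
    [set x | forall u, u \in U -> rnd_cap u x = c u] `&` (std_noise @^-1` rectangle F B).
  apply/seteqP; split => x /=.
    move=> Jx; split => [u Uu|i iF].
      by apply: (Jx (inl u)); rewrite /= (perm_mem Jperm) mem_cat map_f.
    have := Jx (inr i); rewrite /= (perm_mem Jperm) mem_cat (map_f inr iF) orbT => /(_ isT).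
    by rewrite /affine add0r.
  move=> [Ux Fx] j /=; rewrite (perm_mem Jperm) mem_cat => /orP[] /mapP[k kK ->] /=.
    exact: Ux.
  by rewrite /affine add0r; exact: Fx.
rewrite -JE (rnd_independent JA) (perm_big _ Jperm)/= big_cat !big_map/=.
congr (_ * _)%E; apply: eq_bigr => k _; first exact: rnd_cap_uniform.
exact: std_noise_law.
Qed.


Definition std_noise_mfun : {mfun Om >-> T} :=
  HB.pack std_noise (isMeasurableFun.Build _ _ Om T std_noise measurable_std_noise).

Definition noise_law : probability T R := distribution P std_noise_mfun.

Lemma noise_law_gaussian : gaussian_family noise_law.
Proof.
move=> F B mB.
have := @caps_noise_independent [::] _ F B isT (fun u => rnd_cap_choices (r := r) u point) mB.
rewrite big_nil mul1e => <-; rewrite /noise_law /=; congr (P _).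
by apply/seteqP; split => [z|z []].
Qed.

Definition cap_index := {dffun forall u : domf S, cap_choices D0 (S u)}.

Definition cap_of (c : cap_index) : domf S -> {fset Sigma} := fun u => val (c u).

Lemma cap_of_choices c u : cap_of c u \in cap_choices D0 (S u).
Proof. exact: valP. Qed.

Definition cap_event (c : cap_index) : set Om := [set x | forall u, rnd_cap u x = cap_of c u].

Lemma measurable_cap_event c : measurable (cap_event c).
Proof.
rewrite (_ : cap_event c = \big[setI/setT]_(u <- enum {: domf S})
    (rnd_cap (r := r) u @^-1` [set cap_of c u])).
  by apply: big_ind => //; [exact: measurableI|move=> u _; exact: rnd_cap_measurable].
rewrite -bigcap_seq; apply/seteqP; split => x /= h u => [_|]; first exact: h.
by apply: h; rewrite /= mem_enum.
Qed.

(** Independence passes from rectangles to every event by uniqueness of measures. Since [mu] is any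
    Gaussian family, runs on different probability spaces can be compared through one common
    [mu]. *)
Lemma caps_noise_law (mu : probability T R) (c : cap_index) (E : set T) :
  gaussian_family mu -> measurable E ->
  P (cap_event c `&` std_noise @^-1` E) = (cap_weight%:E * mu E)%E.
Proof.
move=> mug mE.
have w0 : 0 <= cap_weight by apply: prodr_ge0 => u _; rewrite invr_ge0.
pose m1 := pushforward (mrestr P (measurable_cap_event c)) std_noise_mfun.
pose m2 := mscale (NngNum w0) mu.
transitivity (m1 E); first by rewrite /m1 /pushforward /mrestr setIC.
transitivity (m2 E); last by [].
apply: cylinders_measure_unique => //.
  apply: (@le_lt_trans _ _ 1%E); last by rewrite ltry.
  apply: probability_le1; apply: measurableI; last exact: measurable_cap_event.
  by rewrite preimage_setT; exact: measurableT.
move=> F B mB.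
have := caps_noise_independent F (enum_uniq {: domf S}) (cap_of_choices c) mB.
rewrite big_enum/= => h.
transitivity (cap_weight%:E * \prod_(i <- F) N (B i))%E; last first.
  by rewrite -mug.
rewrite /cap_weight -prodEFin -h /m1/= /pushforward/= /mrestr setIC.
congr (P (_ `&` _)); apply/seteqP; split => x /= hx u => [_|]; first exact: hx.
by apply: hx; rewrite mem_enum.
Qed.

Lemma cap_event_cover (x : Om) : exists c, cap_event c x.
Proof.
pose c : cap_index := [ffun u => [` rnd_cap_choices (r := r) u x]%fset].
by exists c => u; rewrite /cap_of ffunE.
Qed.

Lemma cap_partition (A : set Om) : measurable A ->
  P A = (\sum_(c : cap_index) P (cap_event c `&` A))%E.
Proof.
move=> mA.
rewrite [in LHS](_ : A = \bigcup_(c in [set` enum {: cap_index}]) (cap_event c `&` A)).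
  rewrite measure_fin_bigcup//.
  - by rewrite -fsbig_seq ?enum_uniq// big_enum.
  - move=> c c' _ _ [x [[/= cx _] [c'x _]]]; apply/ffunP => u; apply/val_inj.
    by have := cx u; rewrite c'x.
  - by move=> c _; apply: measurableI => //; exact: measurable_cap_event.
apply/seteqP; split => x /=; last by move=> [c _ []].
by move=> Ax; have [c cx] := cap_event_cover x; exists c; rewrite /= ?mem_enum.
Qed.

Lemma sum_cap_weight : (\sum_(c : cap_index) cap_weight%:E = 1)%E.
Proof.
rewrite -(probability_setT P) (cap_partition measurableT); apply: eq_bigr => c _.
rewrite -[LHS]mule1 -(probability_setT noise_law).
by rewrite -(caps_noise_law c noise_law_gaussian measurableT).
Qed.

Lemma cap_weight_ge0 : 0 <= cap_weight.
Proof. by apply: prodr_ge0 => u _; rewrite invr_ge0. Qed.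

Definition accepted (mu : set T -> \bar R) (ALG : weighting R Sigma) (rho : R)
    (O : set (output R Sigma)) (C : dataset Sigma) : \bar R :=
  mu [set z | O (threshold_out rho (items C) (perturb (base_weight ALG C) sigma z))].

(* [H] is the dataset on which the weights are computed, as a function of the
   capped sets; it is not always the capped version of [S]. *)
Lemma run_law (mu : probability T R) (ALG : weighting R Sigma) (rho : R)
    (H : (domf S -> {fset Sigma}) -> dataset Sigma) O :
  gaussian_family mu -> output_events O ->
  P [set x | O (weight_and_threshold_out ALG rho (H (fun u => rnd_cap u x))
                  (fun i => rnd_noise r i x))] =
  (\sum_(c : cap_index) cap_weight%:E * accepted mu ALG rho O (H (cap_of c)))%E.
Proof.
move=> mug mO; set A := [set x | _].
pose E C := [set z : T |
  O (threshold_out rho (items C) (perturb (base_weight ALG C) sigma z))].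
have mE C : measurable (E C).
  exact: (measurable_preimage (measurable_perturb _ _)
    (measurable_threshold_out rho (items C) mO)).
have AE c : cap_event c `&` A = cap_event c `&` std_noise @^-1` E (H (cap_of c)).
  apply/seteqP; split => x /= -[cx]; rewrite /A/=.
    have -> : (fun u => rnd_cap u x) = cap_of c by apply/funext.
    rewrite weight_and_threshold_outE => Ox; split => //; move: Ox; rewrite /E/=.
    congr (O (threshold_out _ _ _)); apply/funext => i.
    by rewrite /perturb /std_noise mulVKf ?gt_eqF.
  have -> : (fun u => rnd_cap u x) = cap_of c by apply/funext.
  rewrite weight_and_threshold_outE /E/= => Ox; split => //; move: Ox.
  congr (O (threshold_out _ _ _)); apply/funext => i.
  by rewrite /perturb /std_noise mulVKf ?gt_eqF.
have mcE c : measurable (cap_event c `&` A).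
  rewrite AE; apply: measurableI; first exact: measurable_cap_event.
  exact: measurable_preimage measurable_std_noise (mE _).
have mA : measurable A.
  rewrite (_ : A = \bigcup_(c in [set` enum {: cap_index}]) (cap_event c `&` A)).
    by apply: fin_bigcup_measurable => //; exact: finite_set_seq.
  apply/seteqP; split => x; last by move=> [c _ []].
  by move=> Ax; have [c cx] := cap_event_cover x; exists c; rewrite /= ?mem_enum.
rewrite (cap_partition mA); apply: eq_bigr => c _.
by rewrite AE (caps_noise_law c mug (mE _)).
Qed.

End randomness.

(** * Neighbouring datasets *)

Section restriction.
Context {R : realType} {Sigma : choiceType}.
Variables (D0 : nat) (sigma : R) (S S' : dataset Sigma) (incl : domf S -> domf S').
Hypothesis incl_inj : injective incl.
Hypothesis inclE : forall u, S' (incl u) = S u.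
Variable r : randomness D0 sigma S'.

Lemma restrict_independent : mutually_independent (rnd_prob r)
  (randomness_events (fun u => rnd_cap (r := r) (incl u)) (fun i => rnd_noise r i : _ -> R)).
Proof.
move=> F A EA.
pose f (j : domf S + Sigma) : domf S' + Sigma :=
  match j with inl u => inl (incl u) | inr i => inr i end.
have f_inj : injective f by move=> [u|i] [u'|i'] //= [] => [/incl_inj|] ->.
(* By injectivity each fibre of [f] has at most one element, so this intersection transports [A]
   along [f] without an inverse function. *)
pose A' j' := \bigcap_(j in [set j | f j = j']) A j.
have A'E j : A' (f j) = A j.
  by apply/seteqP; split => x /= => [|Ax k /f_inj ->//]; apply.
have EA' j' : j' \in [fset f j | j in F]%fset ->
    randomness_events (rnd_cap (r := r)) (fun i => rnd_noise r i : _ -> R) j' (A' j').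
  by move=> /imfsetP[j /= /EA jF ->]; rewrite A'E; case: j jF.
have -> : \bigcap_(j in [set` F]) A j = \bigcap_(j in [set` [fset f j | j in F]%fset]) A' j.
  apply/seteqP; split => x Ax.
    by move=> _ /imfsetP[j /= jF ->]; rewrite A'E; exact: Ax.
  by move=> j /= jF; rewrite -A'E; apply: Ax; apply/imfsetP; exists j.
rewrite (rnd_independent EA') big_imfset/=; last by move=> ? ? _ _; exact: f_inj.
by apply: eq_bigr => j _; rewrite A'E.
Qed.

(** Forgetting the capped sets of the users outside the image of [incl] lets a run on [S] live on
    the probability space of the run on [S']. *)
Definition restrict_randomness : randomness D0 sigma S.
Proof.
refine (@Randomness R Sigma D0 sigma S _ _ (rnd_prob r)
  (fun u => rnd_cap (r := r) (incl u)) (rnd_noise r) _ _ _ _ restrict_independent).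
- by move=> u x; rewrite -inclE; exact: rnd_cap_choices.
- by move=> u B; exact: rnd_cap_measurable.
- by move=> u B; rewrite -inclE; exact: rnd_cap_uniform.
- by move=> i B mB; exact: rnd_noise_normal.
Defined.

End restriction.

(** * Privacy for fixed capped sets *)

Section privacy.
Context {R : realType} {Sigma : choiceType}.
Variables (eps delta : R) (D0 : nat) (ALG : weighting R Sigma) (h : nat -> R) (sigma : R).
Hypotheses (hdelta : 0 < delta < 1) (hl2 : (l2_sensitivity ALG D0 <= 1)%E).
Hypothesis hlinf : forall t : nat, (1 <= t <= D0)%N ->
  (novel_linf_sensitivity ALG D0 t <= (h t)%:E)%E.
Hypothesis hsigma : gaussian_noise_level eps delta sigma.
Local Notation T := (cylinders R Sigma).
Local Notation rho := (threshold delta sigma D0 h).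
Implicit Types C : dataset Sigma.

Lemma items_sub C C' : add_user C C' -> {subset items C <= items C'}.
Proof. by move=> [v [A [vC ->]]] i iC; rewrite items_add// iC. Qed.

(** Every novel item belongs to the new user, whose set is bounded. *)
Lemma novel_card C C' : add_user C C' -> bounded_users D0 C' -> (#|` novel C C'| <= D0)%N.
Proof.
move=> [v [A [vC C'E]]] bC'; rewrite C'E in bC' *.
have vC' : v \in domf C.[v <- A]%fmap by rewrite mem_setf inE eqxx.
have := bC' [` vC']%fset; rewrite getf_set => /(leq_trans _); apply.
apply: fsubset_leq_card; apply/fsubsetP => i; rewrite inE items_add//.
by case/andP => /negbTE ->.
Qed.

Lemma l2_sensitivity_le C C' : add_user C C' -> bounded_users D0 C -> bounded_users D0 C' ->
  \sum_(i <- items C) (ALG C' i - ALG C i) ^+ 2 + \sum_(i <- novel C C') ALG C' i ^+ 2 <= 1.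
Proof.
move=> CC' bC bC'; set X := _ + _.
have X0 : 0 <= X by rewrite addr_ge0// sumr_ge0// => i _; exact: sqr_ge0.
suff : ((Num.sqrt X)%:E <= 1)%E.
  rewrite lee_fin => X1; rewrite -(sqr_sqrtr X0) -(expr1n _ 2).
  by rewrite ler_sqr ?nnegrE ?sqrtr_ge0.
apply: le_trans hl2; apply: le_ereal_inf_tmp => _ [d dP <-].
by rewrite lee_fin; exact: dP.
Qed.

(** Both bounds hold for every admissible [d] and pass to the infimum. Nonnegativity of [h] serves
    the run on [C], where a novel item has weight 0. *)
Lemma novel_weight_le C C' : add_user C C' -> bounded_users D0 C -> bounded_users D0 C' ->
  forall i, i \in novel C C' -> 0 <= h #|` novel C C'| /\ ALG C' i <= h #|` novel C C'|.
Proof.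
move=> CC' bC bC' i iN.
have t1 : (1 <= #|` novel C C'| <= D0)%N.
  by rewrite novel_card// andbT cardfs_gt0; apply/fset0Pn; exists i.
split; rewrite -lee_fin; apply: le_trans (hlinf t1); apply: le_ereal_inf_tmp => _ [d [d0 dP] <-].
  by rewrite lee_fin.
by rewrite lee_fin; exact: dP CC' bC bC' erefl _ iN.
Qed.

Lemma threshold_term_le t : (1 <= t <= D0)%N -> threshold_term delta sigma h t <= rho.
Proof.
move=> /andP[t1 tD]; apply: (@le_bigmax_seq _ _ _ _ _ t xpredT) => //.
by rewrite mem_index_iota t1.
Qed.

Variable mu : probability T R.
Hypothesis mu_gauss : gaussian_family mu.
Local Notation Q := (accepted sigma mu ALG rho).

(** The number of novel items is one of the indices [t] over which the threshold is a maximum. *)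
Lemma novel_tail C C' (m : Sigma -> R) : add_user C C' -> bounded_users D0 C' ->
  (forall i, i \in novel C C' -> m i <= h #|` novel C C'|) ->
  (mu [set z | exists2 i, i \in novel C C' & (rho <= perturb m sigma z i)%R]
   <= (delta / 2)%:E)%E.
Proof.
move=> CC' bC' mh; have [s0 _] := hsigma.
apply: (tail_bound mu_gauss s0 hdelta mh) => N0; apply: threshold_term_le.
by rewrite novel_card// andbT cardfs_gt0.
Qed.

(** With weights extended by 0, the old and the novel items contribute the two sums in the
    definition of the sensitivity. *)
Lemma base_weight_sum C C' : add_user C C' -> bounded_users D0 C -> bounded_users D0 C' ->
  \sum_(i <- items C') (base_weight ALG C' i - base_weight ALG C i) ^+ 2 <= 1.
Proof.
move=> CC' bC bC'; apply: le_trans (l2_sensitivity_le CC' bC bC').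
have perm : perm_eq (items C') (items C ++ novel C C').
  apply: uniq_perm; first exact: fset_uniq.
    rewrite cat_uniq !fset_uniq/= andbT; apply/hasPn => i; rewrite inE.
    by case/andP.
  move=> i; rewrite mem_cat [in RHS]inE; case: (boolP (i \in items C)) => //= iC.
  exact: items_sub CC' _ iC.
rewrite (perm_big _ perm)/= big_cat/= lerD//.
  rewrite big_seq [leRHS]big_seq; apply: ler_sum => i iC.
  by rewrite /base_weight iC (items_sub CC' iC).
rewrite big_seq [leRHS]big_seq; apply: ler_sum => i; rewrite inE => /andP[/negbTE iC iC'].
by rewrite /base_weight iC iC' subr0.
Qed.

Lemma threshold_out_novel C C' (y : Sigma -> R) : add_user C C' ->
  (forall i, i \in novel C C' -> y i < rho) ->
  threshold_out rho (items C) y = threshold_out rho (items C') y.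
Proof.
move=> CC' yN; congr pair; apply/fsetP => i; rewrite !inE/=.
case: (boolP (i \in items C)) => [iC|iC]; first by rewrite (items_sub CC' iC).
case: (boolP (i \in items C')) => //= iC'; rewrite leNgt yN//.
by rewrite inE iC.
Qed.

(** In each direction the exceptional event is measured under the run on the left of the inequality:
    novel items have weight 0 there for [C], and weight at most [h] of their number for [C']. *)
Lemma capped_private C C' O : add_user C C' -> bounded_users D0 C -> bounded_users D0 C' ->
  output_events O ->
  (Q O C <= (expR eps)%:E * Q O C' + delta%:E)%E /\
  (Q O C' <= (expR eps)%:E * Q O C + delta%:E)%E.
Proof.
move=> CC' bC bC' mO.
have off i : i \notin items C' -> base_weight ALG C i = base_weight ALG C' i.
  move=> iC'; rewrite /base_weight (negbTE iC') ifN//.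
  by apply: contra iC'; exact: items_sub.
have sum1 := base_weight_sum CC' bC bC'.
split.
- apply: (threshold_private mu_gauss hsigma _ _ off sum1) => //.
    by move=> y; exact: threshold_out_novel.
  apply: novel_tail => // i iN; have [h0 _] := novel_weight_le CC' bC bC' iN.
  by move: (iN); rewrite inE => /andP[/negbTE iC _]; rewrite /base_weight iC.
- apply: (threshold_private (F := novel C C') mu_gauss hsigma _ _
      (fun i iC' => esym (off i iC'))) => //.
  + by move=> y yN; apply/esym; exact: (threshold_out_novel CC').
  + apply: novel_tail => // i iN; have [_ hw] := novel_weight_le CC' bC bC' iN.
    by move: (iN); rewrite inE => /andP[_ iC']; rewrite /base_weight iC'.
  + by under eq_bigr do rewrite -sqrrN opprB.
Qed.

End privacy.

(** * Averaging over the random capping *)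

Section average.
Context {R : realType}.
Local Open Scope ereal_scope.

(** The privacy inequality is affine and the weights sum to 1, so the additive term is preserved by
    averaging. *)
Lemma average_le (J : finType) (w e d : R) (a b : J -> \bar R) : (0 <= w)%R -> (0 <= e)%R ->
  \sum_(j : J) w%:E = 1 -> (forall j, 0 <= b j) -> (0 <= d)%R ->
  (forall j, a j <= e%:E * b j + d%:E) ->
  \sum_j w%:E * a j <= e%:E * (\sum_j w%:E * b j) + d%:E.
Proof.
move=> w0 e0 w1 b0 d0 ab.
rewrite -[X in _ + X]mul1e -w1 ge0_sume_distrl//.
rewrite ge0_sume_distrr//; last by move=> j _; rewrite mule_ge0.
rewrite -big_split/=; apply: lee_sum => j _.
by rewrite muleCA -ge0_muleDr ?lee_fin// ?mule_ge0 ?lee_fin// lee_wpmul2l.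
Qed.

End average.

Section add_user.
Context {Sigma : choiceType}.
Variables (S : dataset Sigma) (v : nat) (A : {fset Sigma}).
Hypothesis vS : v \notin domf S.
Local Notation S' := (S.[v <- A]%fmap).

Lemma old_user_in (u : domf S) : val u \in domf S'.
Proof. by rewrite mem_setf inE orbC (valP u). Qed.

Definition old_user (u : domf S) : domf S' := [` old_user_in u]%fset.

Lemma old_user_inj : injective old_user.
Proof. by move=> u u' [] /val_inj. Qed.

Lemma old_userE u : S' (old_user u) = S u.
Proof.
apply: Some_inj; rewrite !Some_fnd fnd_set /=; case: eqP => // uv.
by have := valP u; rewrite /= uv (negbTE vS).
Qed.

Lemma capped_add_user (c : domf S' -> {fset Sigma}) :
  add_user (capped (fun u => c (old_user u))) (capped c).
Proof.
have vS' : v \in domf S' by rewrite mem_setf inE eqxx.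
exists v, (c [` vS']%fset); split => //.
apply/fmapP => u; rewrite fnd_set; case: eqP => [->|/eqP uv].
  by rewrite in_fnd ffunE.
case: (boolP (u \in domf S)) => uS.
  have uS' : u \in domf (capped c) by rewrite /= inE uS orbT.
  rewrite !in_fnd !ffunE; congr (Some (c _)); exact: val_inj.
have uS' : u \notin domf (capped c) by rewrite /= in_fset1U negb_or uv.
by rewrite (not_fnd uS') not_fnd.
Qed.

End add_user.

Section main.
Context {R : realType} {Sigma : choiceType}.
Variables (eps delta : R) (D0 : nat) (ALG : weighting R Sigma) (h : nat -> R) (sigma : R).
Hypotheses (hdelta : 0 < delta < 1) (hl2 : (l2_sensitivity ALG D0 <= 1)%E).
Hypothesis hlinf : forall t : nat, (1 <= t <= D0)%N ->
  (novel_linf_sensitivity ALG D0 t <= (h t)%:E)%E.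
Hypothesis hsigma : gaussian_noise_level eps delta sigma.
Variable r : forall S : dataset Sigma, randomness D0 sigma S.
Local Notation M S := (WeightAndThreshold delta ALG h (r S)).

(* The users of [S] are capped on the probability space of the run on [S'], so
   that the two runs differ only by the capped set of the new user. *)
Lemma add_user_private S S' O : add_user S S' -> output_events O ->
  (M S O <= (expR eps)%:E * M S' O + delta%:E)%E /\
  (M S' O <= (expR eps)%:E * M S O + delta%:E)%E.
Proof.
move=> [v [A [vS S'E]]] mO; rewrite {S'}S'E; set S' := S.[v <- A]%fmap.
have [s0 _] := hsigma.
pose mu := noise_law (r S').
have mug : gaussian_family mu := noise_law_gaussian (r S') s0.
pose rho := threshold delta sigma D0 h.
pose r' := restrict_randomness (@old_user_inj _ S v A) (old_userE A vS) (r S').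
pose Q := accepted sigma mu ALG rho O.
pose C (c : cap_index D0 S') := capped (fun u : domf S => cap_of c (old_user v A u)).
pose C' (c : cap_index D0 S') := capped (cap_of c).
have MS : M S O = (\sum_(c : cap_index D0 S') (cap_weight D0 S')%:E * Q (C c))%E.
  (* The formula of [run_law] depends on the randomness only through its law, so the given run on
     [S] may be replaced by the restricted one. *)
  have -> : M S O = WeightAndThreshold delta ALG h r' O.
    rewrite /WeightAndThreshold (run_law (r S) s0 ALG rho (@capped _ S) mug mO).
    by rewrite (run_law r' s0 ALG rho (@capped _ S) mug mO).
  exact: (run_law (r S') s0 ALG rho (fun c => capped (fun u => c (old_user v A u))) mug mO).
have MS' : M S' O = (\sum_(c : cap_index D0 S') (cap_weight D0 S')%:E * Q (C' c))%E.
  exact: run_law.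
have key c : (Q (C c) <= (expR eps)%:E * Q (C' c) + delta%:E)%E /\
             (Q (C' c) <= (expR eps)%:E * Q (C c) + delta%:E)%E.
  apply: (capped_private hdelta hl2 hlinf hsigma mug) mO.
  - exact: capped_add_user.
  - apply: capped_bounded => u; rewrite -(old_userE A vS); exact: cap_of_choices.
  - by apply: capped_bounded => u; exact: cap_of_choices.
have Q0 c : (0 <= Q c)%E by exact: measure_ge0.
have w1 := sum_cap_weight (r S') s0.
have [d0 _] := andP hdelta.
by rewrite MS MS'; split; apply: average_le => //;
  rewrite ?cap_weight_ge0 ?expR_ge0 ?(ltW d0)// => c; have [] := key c.
Qed.

End main.

Theorem theorem9 (R : realType) (Sigma : choiceType) (eps delta : R)
    (D0 : nat) (ALG : weighting R Sigma) (h : nat -> R) (sigma : R)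
    (heps : 0 < eps) (hdelta : 0 < delta < 1) (hD0 : (0 < D0)%N)
    (hl2 : (l2_sensitivity ALG D0 <= 1)%E)
    (hlinf : forall t : nat, (1 <= t <= D0)%N ->
       (novel_linf_sensitivity ALG D0 t <= (h t)%:E)%E)
    (hsigma : gaussian_noise_level eps delta sigma)
    (r : forall S : dataset Sigma, randomness D0 sigma S) :
  differentially_private eps delta
    (fun S => WeightAndThreshold delta ALG h (r S)).
Proof.
by move=> S S' [SS'|SS'] O mO;
  have [? ?] := add_user_private hdelta hl2 hlinf hsigma r SS' mO.
Qed.
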